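(* Let $\varphi\in L^\infty(\mathbb D)$, let $\rho_0=\frac1{32}\min(1,\|\varphi\|_\infty^{-1})$, and let $\rho\in(0,\rho_0)$. Suppose that (i) $\operatorname{Re}\varphi(z)\ge|\operatorname{Im}\varphi(z)|^2$ for all $z\in\mathbb D$ with $|\varphi(z)|\ge\rho$; (ii) $|\varphi(z)|>\rho$ for all $z\in\mathbb D$ with $|z|\ge\rho$; and (iii) the set $\Lambda=\{z\in\mathbb D:|\varphi(z)|\le\rho\}$ has area $|\Lambda|\le\rho^6$ (area measured with the normalized measure $dA$). Then the Toeplitz operator $T_\varphi$ is invertible on $A^2$.
   Context: $\mathbb D$ is the open unit disc, $dA=\frac1\pi r\,dr\,d\theta$ normalized area measure, $A^2$ the Bergman space of analytic functions in $L^2(\mathbb D,dA)$, $P$ the orthogonal projection $L^2\to A^2$, and for $\varphi\in L^\infty(\mathbb D)$ the Toeplitz operator is $T_\varphi f=P(\varphi f)$ on $A^2$. $\|\cdot\|_\infty$ is the (essential) supremum norm. *)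

(* Defs.v *)
(* MathComp + MathComp-Analysis, complex numbers R[i] from real_closed. *)
From HB Require Import structures.
From mathcomp Require Import all_boot all_order all_algebra.
From mathcomp Require Import all_classical all_reals all_analysis.
From mathcomp Require Import ess_sup_inf complex.
Set Implicit Arguments. Unset Strict Implicit. Unset Printing Implicit Defensive.
Import Order.TTheory GRing.Theory Num.Theory.
Import numFieldNormedType.Exports.
Local Open Scope classical_set_scope.
Local Open Scope ring_scope.

Section Bergman.
Variable R : realType.
Local Notation C := R[i].

(* modulus |z| of a complex number, as a real number *)
Definition cabs (z : C) : R := complex.Re `|z|.

(* the point x + i y of the complex plane *)
Definition cplx (p : R * R) : C := (p.1 +i* p.2)%C.

(* the open unit disc, in the complex plane and in R^2 *)
Definition inD (z : C) : Prop := cabs z < 1.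
Definition disc : set (R * R) := [set p | inD (cplx p)].

(* two-dimensional Lebesgue measure on R^2 = C *)
Definition leb2 := ((@lebesgue_measure R) \x (@lebesgue_measure R))%E.

(* normalized area measure dA = (1/pi) dx dy, for subsets of the disc *)
Definition area (E : set (R * R)) : \bar R := ((pi^-1)%:E * leb2 E)%E.

(* integral over the disc with respect to dA of a real function *)
Definition intD (g : R * R -> R) : R := pi^-1 * Rintegral leb2 disc g.

(* integral over the disc with respect to dA of a complex function *)
Definition cintD (w : C -> C) : C :=
  (intD (fun p => complex.Re (w (cplx p))) +i* intD (fun p => complex.Im (w (cplx p))))%C.

(* measurability of a complex function on the disc *)
Definition cmeasurable (u : C -> C) : Prop :=
  measurable_fun disc (fun p => complex.Re (u (cplx p))) /\
  measurable_fun disc (fun p => complex.Im (u (cplx p))).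

(* u in L^2(D, dA) *)
Definition L2 (u : C -> C) : Prop :=
  cmeasurable u /\
  (\int[leb2]_(p in disc) ((cabs (u (cplx p))) ^+ 2)%:E < +oo)%E.

(* L^2(D, dA) norm *)
Definition L2norm (u : C -> C) : R := Num.sqrt (intD (fun p => (cabs (u (cplx p))) ^+ 2)).

(* L^2(D, dA) inner product <u, v> = int_D u conj(v) dA *)
Definition inner (u v : C -> C) : C := cintD (fun z => u z * (v z)^*)%C.

(* essential supremum norm on the disc: ||phi||_oo (an extended real) *)
Definition Linfnorm (phi : C -> C) : \bar R :=
  ess_sup leb2 (fun p => (if `[< disc p >] then cabs (phi (cplx p)) else 0)%:E).

(* phi in L^oo(D) *)
Definition Linf (phi : C -> C) : Prop :=
  cmeasurable phi /\ (Linfnorm phi < +oo)%E.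

(* complex differentiability (holomorphy) at every point of the disc *)
Definition holomorphic_on_D (f : C -> C) : Prop :=
  forall z, inD z -> exists l : C, forall e : R, 0 < e -> exists2 d : R, 0 < d &
    forall h : C, h != 0 -> cabs h < d -> inD (z + h) ->
      cabs ((f (z + h) - f z) / h - l) < e.

(* the Bergman space A^2 *)
Definition A2 (f : C -> C) : Prop := holomorphic_on_D f /\ L2 f.

(* g = P u, where P is the orthogonal projection L^2 -> A^2:
   g is the element of A^2 such that u - g is orthogonal to A^2 *)
Definition bergman_proj (u g : C -> C) : Prop :=
  A2 g /\ forall h, A2 h -> inner u h = inner g h.

(* g = T_phi f = P(phi f) *)
Definition toeplitz (phi f g : C -> C) : Prop :=
  bergman_proj (fun z => phi z * f z) g.

(* T_phi is invertible on A^2: bijective on A^2 (elements of A^2 being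
   identified when they agree on D) with bounded inverse *)
Definition toeplitz_invertible (phi : C -> C) : Prop :=
  (forall g, A2 g -> exists f, A2 f /\ toeplitz phi f g) /\
  (forall f1 f2 g, A2 f1 -> A2 f2 -> toeplitz phi f1 g -> toeplitz phi f2 g ->
     forall z, inD z -> f1 z = f2 z) /\
  (exists2 K : R, 0 < K & forall f g, A2 f -> toeplitz phi f g ->
     L2norm f <= K * L2norm g).

End Bergman.

(* Main.v *)
(** Off the small set [Lambda] the hypotheses force [Re phi >= rho^2 / 2], while on
    [Lambda], which lies in a small disc around the origin and has area at most
    [rho^6], point evaluations are bounded on the Bergman space.  Hence
    [Re <phi f, f> >= (rho^2 / 4) |f|^2], and a bounded coercive operator on a
    Hilbert space is invertible.

    Holomorphy being mere complex differentiability, the function theory starts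
    from Goursat's theorem on rectangles.  Cauchy's formula gives
    [|F w| <= K max |F|] over the boundary, and applying this to the powers of [F]
    gives the maximum principle.  Applied to difference quotients, the latter yields
    Lipschitz estimates, from which follow both the boundedness of point evaluations
    (by a weighted maximum argument) and the completeness of the Bergman space. *)

Require Import Defs.
From HB Require Import structures.
From mathcomp Require Import all_boot all_order all_algebra.
From mathcomp Require Import all_classical all_reals all_analysis.
From mathcomp Require Import measurable_realfun ess_sup_inf complex.
From mathcomp Require Import ring lra.
Import Order.TTheory GRing.Theory Num.Theory.
Import numFieldNormedType.Exports.
Local Open Scope classical_set_scope.
Local Open Scope ring_scope.

Set Implicit Arguments.
Unset Strict Implicit.
Unset Printing Implicit Defensive.

(** * Real-valued modulus of complex numbers *)

Section ComplexModulus.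
Variable R : realType.
Local Notation C := R[i].
Implicit Types (z w : C) (x y : R).

(** On [Lambda] the real part of the form may be as low as [- rho * |f|^2]. There [|f|^2] is at most
    a fixed multiple of the whole energy, so the loss is of order [rho * |Lambda|], that is [rho^7],
    against a gain of order [rho^2]. Hence the point evaluation estimate must carry an explicit
    constant, small enough to be absorbed by [rho < 1/32]; the constants in the contour estimates
    before it may be crude, since they disappear when powers are taken.

    Contours are boundaries of rectangles and neighbourhoods are squares. Instead of averaging [f]
    over a disc, the point evaluation estimate exhibits a square on which [|f|] stays bounded below.

    The Hilbert space part is real: [A2] is stable under multiplication by [i], so an identity of
    inner products against all of [A2] amounts to the identity of their real parts. Surjectivity
    follows from two facts about the range: it is complete, because the operator is bounded below,
    and only elements of zero energy are orthogonal to it, because of coercivity. *)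

Lemma cabsC z : (cabs z)%:C%C = `|z| :> C.
Proof. by rewrite /cabs normc_def. Qed.

Lemma cabsE z :
  cabs z = Num.sqrt (complex.Re z ^+ 2 + complex.Im z ^+ 2).
Proof. by rewrite /cabs normc_def. Qed.

Lemma sqr_cabs z : cabs z ^+ 2 = complex.Re z ^+ 2 + complex.Im z ^+ 2.
Proof. by rewrite cabsE sqr_sqrtr // addr_ge0 ?sqr_ge0. Qed.

Lemma cabs_ge0 z : 0 <= cabs z.
Proof. by rewrite cabsE sqrtr_ge0. Qed.

Lemma cabs0 : cabs (0 : C) = 0.
Proof. by rewrite /cabs normr0. Qed.

Lemma cabs_eq0 z : (cabs z == 0) = (z == 0).
Proof. by rewrite -(inj_eq (@complexI R)) cabsC normr_eq0. Qed.

Lemma cabs_gt0 z : (0 < cabs z) = (z != 0).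
Proof. by rewrite lt_def cabs_eq0 cabs_ge0 andbT. Qed.

Lemma cabsM z w : cabs (z * w) = cabs z * cabs w.
Proof. by apply: (@complexI R); rewrite cabsC normrM rmorphM /= !cabsC. Qed.

Lemma cabsX z n : cabs (z ^+ n) = cabs z ^+ n.
Proof. by apply: (@complexI R); rewrite cabsC normrX rmorphXn /= cabsC. Qed.

Lemma cabsV z : cabs z^-1 = (cabs z)^-1.
Proof. by apply: (@complexI R); rewrite cabsC normfV fmorphV /= cabsC. Qed.

Lemma cabsN z : cabs (- z) = cabs z.
Proof. by rewrite /cabs normrN. Qed.

Lemma cabsBC z w : cabs (z - w) = cabs (w - z).
Proof. by rewrite -cabsN opprB. Qed.

Lemma cabsD z w : cabs (z + w) <= cabs z + cabs w.
Proof. by rewrite -lecR rmorphD /= !cabsC ler_normD. Qed.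

Lemma cabsB z w : cabs (z - w) <= cabs z + cabs w.
Proof. by rewrite -(cabsN w) cabsD. Qed.

Lemma cabs_i : cabs ('i%C : C) = 1.
Proof. by rewrite cabsE /= expr0n /= add0r expr1n sqrtr1. Qed.

Lemma normr_Re_le_cabs z : `|complex.Re z| <= cabs z.
Proof. by rewrite cabsE -sqrtr_sqr ler_wsqrtr // lerDl sqr_ge0. Qed.

Lemma normr_Im_le_cabs z : `|complex.Im z| <= cabs z.
Proof. by rewrite cabsE -sqrtr_sqr ler_wsqrtr // lerDr sqr_ge0. Qed.

Lemma cabs_le_ReIm z : cabs z <= `|complex.Re z| + `|complex.Im z|.
Proof.
have [a0 b0] := (normr_ge0 (complex.Re z), normr_ge0 (complex.Im z)).
rewrite -(ler_pXn2r (_ : 0 < 2)%N) ?nnegrE ?cabs_ge0 ?addr_ge0 //.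
rewrite sqr_cabs -(real_normK (num_real (complex.Re z))) -(real_normK (num_real (complex.Im z))).
by rewrite sqrrD lerD2r lerDl mulrn_wge0 // mulr_ge0.
Qed.

Lemma ReB z w : complex.Re (z - w) = complex.Re z - complex.Re w.
Proof. by case: z; case: w. Qed.

Lemma ImB z w : complex.Im (z - w) = complex.Im z - complex.Im w.
Proof. by case: z; case: w. Qed.

Lemma ReD z w : complex.Re (z + w) = complex.Re z + complex.Re w.
Proof. by case: z; case: w. Qed.

Lemma ImD z w : complex.Im (z + w) = complex.Im z + complex.Im w.
Proof. by case: z; case: w. Qed.

Lemma ReM z w : complex.Re (z * w) =
  complex.Re z * complex.Re w - complex.Im z * complex.Im w.
Proof. by case: z; case: w. Qed.

Lemma ImM z w : complex.Im (z * w) =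
  complex.Re z * complex.Im w + complex.Im z * complex.Re w.
Proof. by case: z => a b; case: w => c d /=; rewrite mulrC. Qed.

Lemma ReIm_inj z w : complex.Re z = complex.Re w ->
  complex.Im z = complex.Im w -> z = w.
Proof. by case: z => a b; case: w => c d /= -> ->. Qed.

End ComplexModulus.

(** * Continuity and complex differentiability at a point *)

Section ComplexDifferentiability.
Variable R : realType.
Local Notation C := R[i].
Implicit Types (f g k : C -> C) (z w : C).

Definition ccont f z := forall e : R, 0 < e -> exists2 d : R, 0 < d &
  forall w, cabs (w - z) < d -> cabs (f w - f z) < e.

(* Caratheodory's form of differentiability: the difference quotient extends
   continuously. *)
Definition cdiff f z := exists2 g, ccont g z & exists2 d : R, 0 < d &
  forall w, cabs (w - z) < d -> f w = f z + g w * (w - z).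

Lemma ccont_cst c z : ccont (fun=> c) z.
Proof. by move=> e e0; exists 1 => // w _; rewrite subrr cabs0. Qed.

Lemma ccont_id z : ccont id z.
Proof. by move=> e e0; exists e. Qed.

Lemma ccont_local f g z (d : R) : 0 < d ->
  (forall w, cabs (w - z) < d -> f w = g w) -> ccont g z -> ccont f z.
Proof.
move=> d0 fg cg e e0; have [d' d'0 H] := cg e e0.
exists (Num.min d d') => [|w]; first by rewrite lt_min d0.
rewrite lt_min => /andP[wd wd']; rewrite !fg ?subrr ?cabs0 //.
exact: H.
Qed.

Lemma ccontD f g z : ccont f z -> ccont g z -> ccont (fun w => f w + g w) z.
Proof.
move=> cf cg e e0; have e2 : 0 < e / 2 by rewrite divr_gt0.
have [d d0 H] := cf _ e2; have [d' d'0 H'] := cg _ e2.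
exists (Num.min d d') => [|w]; first by rewrite lt_min d0.
rewrite lt_min => /andP[/H h /H' h'].
have -> : f w + g w - (f z + g z) = (f w - f z) + (g w - g z) by ring.
have := cabsD (f w - f z) (g w - g z); lra.
Qed.

Lemma ccontM f g z : ccont f z -> ccont g z -> ccont (fun w => f w * g w) z.
Proof.
move=> cf cg e e0.
set A := cabs (f z) + 1; set B := cabs (g z) + 1.
have A0 : 0 < A by rewrite ltr_wpDl // cabs_ge0.
have B0 : 0 < B by rewrite ltr_wpDl // cabs_ge0.
have eA : 0 < e / 2 / A by rewrite !divr_gt0.
have eB : 0 < Num.min 1 (e / 2 / B) by rewrite lt_min ltr01 !divr_gt0.
have [d d0 H] := cf _ eB; have [d' d'0 H'] := cg _ eA.
exists (Num.min d d') => [|w]; first by rewrite lt_min d0.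
rewrite lt_min => /andP[/H + /H'].
rewrite lt_min => /andP[h1 h2 h3].
have -> : f w * g w - f z * g z =
  f w * (g w - g z) + (f w - f z) * g z by ring.
apply: (le_lt_trans (cabsD _ _)); rewrite !cabsM.
have fA : cabs (f w) <= A.
  have -> : f w = f z + (f w - f z) by ring.
  by apply: (le_trans (cabsD _ _)); rewrite lerD2l ltW.
have l1 : cabs (f w) * cabs (g w - g z) <= e / 2.
  apply: (@le_trans _ _ (A * (e / 2 / A))).
    by apply: ler_pM; rewrite ?cabs_ge0 // ltW.
  by rewrite mulrCA divff ?mulr1 // gt_eqF.
have gB : cabs (g z) < B by rewrite ltrDl.
have l2 : cabs (f w - f z) * cabs (g z) < e / 2.
  apply: (@le_lt_trans _ _ ((e / 2 / B) * cabs (g z))).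
    by rewrite ler_wpM2r ?cabs_ge0 // ltW.
  by rewrite mulrAC ltr_pdivrMr // ltr_pM2l // divr_gt0.
lra.
Qed.

Lemma ccontX f z n : ccont f z -> ccont (fun w => f w ^+ n) z.
Proof.
move=> cf; elim: n => [|n IH].
  by move=> e e0; exists 1 => // w _; rewrite !expr0 subrr cabs0.
apply: (@ccont_local _ (fun w => f w * f w ^+ n) _ 1) => // [w _|].
  by rewrite exprS.
exact: ccontM.
Qed.

Lemma ccontV f z : ccont f z -> f z != 0 -> ccont (fun w => (f w)^-1) z.
Proof.
move=> cf fz e e0; have a0 : 0 < cabs (f z) by rewrite cabs_gt0.
have m0 : 0 < Num.min (cabs (f z) / 2) (e * cabs (f z) ^+ 2 / 2).
  by rewrite lt_min !divr_gt0 // mulr_gt0 // exprn_gt0.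
have [d d0 H] := cf _ m0; exists d => // w /H.
rewrite lt_min => /andP[h1 h2].
have fw : cabs (f z) / 2 < cabs (f w).
  have : cabs (f z) <= cabs (f w) + cabs (f w - f z).
    have {1}-> : f z = f w - (f w - f z) by ring.
    exact: cabsB.
  lra.
have fw0 : f w != 0 by rewrite -cabs_gt0; lra.
have -> : (f w)^-1 - (f z)^-1 = - (f w - f z) / (f w * f z).
  by field; rewrite fw0 fz.
rewrite cabsM cabsN cabsV ltr_pdivrMr ?cabsM ?mulr_gt0 ?cabs_gt0 //.
apply: (lt_le_trans h2).
by rewrite -mulrA ler_pM2l // expr2 mulrAC ler_pM2r // ltW.
Qed.

Lemma cdiff_ccont f z : cdiff f z -> ccont f z.
Proof.
move=> [g cg [d d0 H]]; apply: (ccont_local d0 H).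
apply: ccontD; first exact: ccont_cst.
apply: ccontM => //; apply: ccontD; [exact: ccont_id|exact: ccont_cst].
Qed.

Lemma cdiff_cst c z : cdiff (fun=> c) z.
Proof.
exists (fun=> 0); first exact: ccont_cst.
by exists 1 => // w _; rewrite mul0r addr0.
Qed.

Lemma cdiff_id z : cdiff id z.
Proof.
exists (fun=> 1); first exact: ccont_cst.
by exists 1 => // w _; rewrite mul1r addrC subrK.
Qed.

Lemma cdiff_local f g z (d : R) : 0 < d ->
  (forall w, cabs (w - z) < d -> f w = g w) -> cdiff g z -> cdiff f z.
Proof.
move=> d0 fg [k ck [d' d'0 H]]; exists k => //.
exists (Num.min d d') => [|w]; first by rewrite lt_min d0.
rewrite lt_min => /andP[wd wd'].
by rewrite !fg ?subrr ?cabs0 // H.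
Qed.

Lemma cdiffD f g z : cdiff f z -> cdiff g z -> cdiff (fun w => f w + g w) z.
Proof.
move=> [k ck [d d0 H]] [k' ck' [d' d'0 H']].
exists (fun w => k w + k' w); first exact: ccontD.
exists (Num.min d d') => [|w]; first by rewrite lt_min d0.
by rewrite lt_min => /andP[/H -> /H' ->]; ring.
Qed.

Lemma cdiffM f g z : cdiff f z -> cdiff g z -> cdiff (fun w => f w * g w) z.
Proof.
move=> df dg; have cf := cdiff_ccont df.
case: df dg => [k ck [d d0 H]] [k' ck' [d' d'0 H']].
(* This slope comes from [f w (g w - g z) + (f w - f z) g z]; its continuity at [z] uses that of
   [f], hence [cf]. *)
exists (fun w => f w * k' w + k w * g z).
  by apply: ccontD; apply: ccontM => //; exact: ccont_cst.
exists (Num.min d d') => [|w]; first by rewrite lt_min d0.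
by rewrite lt_min => /andP[/H E /H' E']; rewrite E' E; ring.
Qed.

Lemma cdiffX f z n : cdiff f z -> cdiff (fun w => f w ^+ n) z.
Proof.
move=> df; elim: n => [|n IH].
  by apply: (@cdiff_local _ (fun=> 1) _ 1) => //; exact: cdiff_cst.
apply: (@cdiff_local _ (fun w => f w * f w ^+ n) _ 1) => // [w _|].
  by rewrite exprS.
exact: cdiffM.
Qed.

Lemma cdiffB f g z : cdiff f z -> cdiff g z -> cdiff (fun w => f w - g w) z.
Proof.
move=> df dg.
apply: (@cdiff_local _ (fun w => f w + (-1) * g w) _ 1) => // [w _|].
  by rewrite mulN1r.
by apply: cdiffD => //; apply: cdiffM => //; exact: cdiff_cst.
Qed.

Lemma cdiff_invB z0 z : z != z0 -> cdiff (fun w => (w - z0)^-1) z.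
Proof.
move=> zz0; have nz : z - z0 != 0 by rewrite subr_eq0.
exists (fun w => - (w - z0)^-1 * (z - z0)^-1).
  apply: ccontM; last exact: ccont_cst.
  apply: (@ccont_local _ (fun w => (-1) * (w - z0)^-1) _ 1) => // [w _|].
    by rewrite mulN1r.
  apply: ccontM; first exact: ccont_cst.
  apply: ccontV => //; apply: ccontD; [exact: ccont_id|exact: ccont_cst].
exists (cabs (z - z0)) => [|w wz]; first by rewrite cabs_gt0.
have : w - z0 != 0.
  by apply: contraTneq wz => /subr0_eq ->; rewrite cabsBC ltxx.
by move=> wz0; field; rewrite wz0 nz.
Qed.

(** The value [l] at [z0] is left free: it is the derivative exactly when the quotient is continuous
    at [z0]. *)
Definition cquot f z0 (l : C) w := if w == z0 then l else (f w - f z0) / (w - z0).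

Lemma cquotE f z0 l w : w != z0 -> cquot f z0 l w = (f w - f z0) / (w - z0).
Proof. by rewrite /cquot => /negPf ->. Qed.

Lemma cquot_mul f z0 l w : cquot f z0 l w * (w - z0) = f w - f z0.
Proof.
rewrite /cquot; case: eqVneq => [->|wz]; first by rewrite !subrr mulr0.
by rewrite divfK // subr_eq0.
Qed.

Lemma cdiff_cquot f z0 l z : z != z0 -> cdiff f z -> cdiff (cquot f z0 l) z.
Proof.
move=> zz0 df; have d0 : 0 < cabs (z - z0) by rewrite cabs_gt0 subr_eq0.
apply: (cdiff_local d0 (g := fun w => (f w - f z0) * (w - z0)^-1)).
  move=> w wz; rewrite cquotE //.
  by apply: contraTneq wz => ->; rewrite cabsBC ltxx.
apply: cdiffM; last exact: cdiff_invB.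
by apply: cdiffB => //; exact: cdiff_cst.
Qed.

Lemma cdiff_cquot_ccont f z : cdiff f z -> exists l, ccont (cquot f z l) z.
Proof.
move=> [g cg [d d0 H]]; exists (g z); apply: (ccont_local d0 _ cg) => w wz.
rewrite /cquot; case: eqVneq => [->//|wz0].
by rewrite H // addrAC subrr add0r mulfK // subr_eq0.
Qed.

End ComplexDifferentiability.

(** * Integrals of complex functions over real segments *)

Section SegmentIntegral.
Variable R : realType.
Local Notation C := R[i].
Local Notation mu := (@lebesgue_measure R).
Implicit Types (h k : R -> C) (a b x y : R).

Definition lcont h x := forall e : R, 0 < e -> exists2 d : R, 0 < d &
  forall y, `|y - x| < d -> cabs (h y - h x) < e.

(** Continuity is two-sided even at the endpoints. The integrands are restrictions of functions of a
    complex variable that are continuous, in the full sense, at every point of the side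
    considered. *)
Definition lcont_on a b h := forall x, a <= x <= b -> lcont h x.

Definition cint h a b : C :=
  (Rintegral mu `[a, b] (fun x => complex.Re (h x)) +i*
   Rintegral mu `[a, b] (fun x => complex.Im (h x)))%C.

Lemma lcontD h k x : lcont h x -> lcont k x -> lcont (fun y => h y + k y) x.
Proof.
move=> ch ck e e0; have e2 : 0 < e / 2 by rewrite divr_gt0.
have [d d0 H] := ch _ e2; have [d' d'0 H'] := ck _ e2.
exists (Num.min d d') => [|w]; first by rewrite lt_min d0.
rewrite lt_min => /andP[/H l1 /H' l2].
have -> : h w + k w - (h x + k x) = (h w - h x) + (k w - k x) by ring.
have := cabsD (h w - h x) (k w - k x); lra.
Qed.

Lemma lcontN h x : lcont h x -> lcont (fun y => - h y) x.
Proof.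
move=> ch e e0; have [d d0 H] := ch _ e0; exists d => // y /H.
by rewrite -cabsN; congr (cabs _ < _); ring.
Qed.

Lemma lcontB h k x : lcont h x -> lcont k x -> lcont (fun y => h y - k y) x.
Proof. by move=> ch ck; apply: lcontD => //; exact: lcontN. Qed.

Lemma lcont_Re_continuous h x : lcont h x ->
  {for x, continuous (fun y => complex.Re (h y))}.
Proof.
move=> ch; apply/cvgrPdist_lt => e e0; have [d d0 H] := ch _ e0.
apply/nbhs_ballP; exists d => //= y; rewrite /ball /= distrC => /H.
by apply: le_lt_trans; rewrite distrC -ReB; exact: normr_Re_le_cabs.
Qed.

Lemma lcont_Im_continuous h x : lcont h x ->
  {for x, continuous (fun y => complex.Im (h y))}.
Proof.
move=> ch; apply/cvgrPdist_lt => e e0; have [d d0 H] := ch _ e0.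
apply/nbhs_ballP; exists d => //= y; rewrite /ball /= distrC => /H.
by apply: le_lt_trans; rewrite distrC -ImB; exact: normr_Im_le_cabs.
Qed.

Lemma continuous_segment_integrable (f : R -> R) a b :
  (forall x, a <= x <= b -> {for x, continuous f}) ->
  mu.-integrable `[a, b] (EFin \o f).
Proof.
move=> cf; apply: continuous_compact_integrable; first exact: segment_compact.
apply: continuous_in_subspaceT => x; rewrite inE /= in_itv /=; exact: cf.
Qed.

Lemma lcont_on_Re_integrable h a b : lcont_on a b h ->
  mu.-integrable `[a, b] (EFin \o (fun x => complex.Re (h x))).
Proof.
move=> ch; apply: continuous_segment_integrable => x /ch.
exact: lcont_Re_continuous.
Qed.

Lemma lcont_on_Im_integrable h a b : lcont_on a b h ->
  mu.-integrable `[a, b] (EFin \o (fun x => complex.Im (h x))).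
Proof.
move=> ch; apply: continuous_segment_integrable => x /ch.
exact: lcont_Im_continuous.
Qed.

Lemma segment_measure a b : a <= b -> fine (mu `[a, b]) = b - a.
Proof.
rewrite le_eqVlt => /predU1P[->|ab].
  by rewrite lebesgue_measure_itv /= lte_fin ltxx subrr.
by rewrite lebesgue_measure_itv /= lte_fin ab.
Qed.

Lemma cintD h k a b : lcont_on a b h -> lcont_on a b k ->
  cint (fun x => h x + k x) a b = cint h a b + cint k a b.
Proof.
move=> ch ck; apply: ReIm_inj => /=.
  rewrite -RintegralD //; try exact: lcont_on_Re_integrable.
  by apply: eq_Rintegral => x _; rewrite ReD.
rewrite -RintegralD //; try exact: lcont_on_Im_integrable.
by apply: eq_Rintegral => x _; rewrite ImD.
Qed.

Lemma cintZ (c : C) h a b : lcont_on a b h ->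
  cint (fun x => c * h x) a b = c * cint h a b.
Proof.
move=> ch; have iR := lcont_on_Re_integrable ch.
have iI := lcont_on_Im_integrable ch.
have iZ (r : R) (f : R -> R) : mu.-integrable `[a, b] (EFin \o f) ->
    mu.-integrable `[a, b] (EFin \o (fun x => r * f x)).
  by move=> fi; apply: (integrableZl _ r fi).
apply: ReIm_inj.
  rewrite ReM /= -RintegralZl // -RintegralZl // -RintegralB //; try exact: iZ.
  by apply: eq_Rintegral => x _; rewrite ReM.
rewrite ImM /= -RintegralZl // -RintegralZl // -RintegralD //; try exact: iZ.
by apply: eq_Rintegral => x _; rewrite ImM.
Qed.

Lemma cint_cst (c : C) a b : a <= b -> cint (fun=> c) a b = c * (b - a)%:C%C.
Proof.
move=> ab; rewrite /cint !Rintegral_cst // segment_measure //.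
by apply: ReIm_inj; rewrite ?ReM ?ImM /=; ring.
Qed.

Lemma eq_cint h k a b : (forall x, a <= x <= b -> h x = k x) ->
  cint h a b = cint k a b.
Proof.
move=> hk; rewrite /cint; congr (_ +i* _)%C; apply: eq_Rintegral => x;
  by rewrite inE /= in_itv /= => /hk ->.
Qed.

Lemma Rintegral_segment_split (f : R -> R) a m b : a <= m -> m <= b ->
  (forall x, a <= x <= b -> {for x, continuous f}) ->
  Rintegral mu `[a, b] f = Rintegral mu `[a, m] f + Rintegral mu `[m, b] f.
Proof.
move=> am mb cf.
have i1 : mu.-integrable `[a, b] (EFin \o f).
  exact: continuous_segment_integrable.
have i2 : mu.-integrable `[m, b] (EFin \o f).
  apply: continuous_segment_integrable => x /andP[mx xb]; apply: cf.
  by rewrite xb (le_trans am).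
rewrite -(@Rintegral_itv_obnd_cbnd _ m); last first.
  apply: integrableS i2 => //; exact: subset_itv_oc_cc.
by rewrite -(Rintegral_itvB i1) ?bnd_simp // addrC subrK.
Qed.

Lemma cint_split h a m b : a <= m -> m <= b -> lcont_on a b h ->
  cint h a b = cint h a m + cint h m b.
Proof.
move=> am mb ch; apply: ReIm_inj => /=; apply: Rintegral_segment_split => //.
  by move=> x /ch; exact: lcont_Re_continuous.
by move=> x /ch; exact: lcont_Im_continuous.
Qed.

Lemma Rintegral_segment_le (f : R -> R) a b M : a <= b ->
  (forall x, a <= x <= b -> {for x, continuous f}) ->
  (forall x, a <= x <= b -> `|f x| <= M) ->
  `|Rintegral mu `[a, b] f| <= M * (b - a).
Proof.
move=> ab cf fM; have fi := continuous_segment_integrable cf.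
rewrite -segment_measure // -(Rintegral_cst mu) //.
apply: (le_trans (le_normr_Rintegral _ fi)) => //.
apply: le_Rintegral => //.
- exact: (integrable_norm fi).
- by apply: continuous_segment_integrable => x _; exact: cst_continuous.
Qed.

Lemma Rintegral_segment_ge (f : R -> R) a b M : a <= b ->
  (forall x, a <= x <= b -> {for x, continuous f}) ->
  (forall x, a <= x <= b -> M <= f x) ->
  M * (b - a) <= Rintegral mu `[a, b] f.
Proof.
move=> ab cf fM; have fi := continuous_segment_integrable cf.
rewrite -segment_measure // -(Rintegral_cst mu) //.
apply: le_Rintegral => //.
- by apply: continuous_segment_integrable => x _; exact: cst_continuous.
Qed.

(** Real and imaginary parts are bounded separately, whence the factor 2. *)
Lemma cint_le h a b M : a <= b -> lcont_on a b h ->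
  (forall x, a <= x <= b -> cabs (h x) <= M) ->
  cabs (cint h a b) <= 2 * M * (b - a).
Proof.
move=> ab ch hM; apply: (le_trans (cabs_le_ReIm _)).
have -> : 2 * M * (b - a) = M * (b - a) + M * (b - a) by ring.
apply: lerD => /=; apply: Rintegral_segment_le => // x xab.
- exact: lcont_Re_continuous (ch _ xab).
- exact: le_trans (normr_Re_le_cabs _) (hM _ xab).
- exact: lcont_Im_continuous (ch _ xab).
- exact: le_trans (normr_Im_le_cabs _) (hM _ xab).
Qed.

End SegmentIntegral.

(** * Integrals along boundaries of rectangles and Goursat's theorem *)

Section RectangleIntegral.
Variable R : realType.
Local Notation C := R[i].
Implicit Types (f g : C -> C) (a b c d x y : R).

Definition in_rect a b c d (z : C) :=
  (a <= complex.Re z <= b) && (c <= complex.Im z <= d).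

(* The integral of [f dz] along the positively oriented boundary of
   [[a, b] x [c, d]], opposite sides being grouped together. *)
Definition oint f a b c d : C :=
  cint (fun x => f (x +i* c)%C - f (x +i* d)%C) a b +
  'i%C * cint (fun y => f (b +i* y)%C - f (a +i* y)%C) c d.

Lemma ccont_hline f x y : ccont f (x +i* y)%C -> lcont (fun t => f (t +i* y)%C) x.
Proof.
move=> cf e e0; have [d d0 H] := cf e e0; exists d => // t td.
apply: H; apply: (le_lt_trans (cabs_le_ReIm _)) => /=.
by rewrite subrr normr0 addr0.
Qed.

Lemma ccont_vline f x y : ccont f (x +i* y)%C -> lcont (fun t => f (x +i* t)%C) y.
Proof.
move=> cf e e0; have [d d0 H] := cf e e0; exists d => // t td.
apply: H; apply: (le_lt_trans (cabs_le_ReIm _)) => /=.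
by rewrite subrr normr0 add0r.
Qed.

Definition on_boundary a b c d (z : C) := in_rect a b c d z &&
  [|| complex.Re z == a, complex.Re z == b, complex.Im z == c | complex.Im z == d].

Lemma on_boundary_hlines a b c d x : c <= d -> a <= x <= b ->
  on_boundary a b c d (x +i* c)%C /\ on_boundary a b c d (x +i* d)%C.
Proof.
by move=> cd xab; rewrite /on_boundary /in_rect /= xab !lexx cd !eqxx !orbT.
Qed.

Lemma on_boundary_vlines a b c d y : a <= b -> c <= y <= d ->
  on_boundary a b c d (b +i* y)%C /\ on_boundary a b c d (a +i* y)%C.
Proof.
by move=> ab ycd; rewrite /on_boundary /in_rect /= ycd !lexx ab !eqxx !orbT.
Qed.

Lemma lcont_on_hlines f a b c d : c <= d ->
  (forall z, on_boundary a b c d z -> ccont f z) ->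
  lcont_on a b (fun x => f (x +i* c)%C - f (x +i* d)%C).
Proof.
move=> cd cf x /(on_boundary_hlines cd)[b1 b2].
by apply: lcontB; apply: ccont_hline; exact: cf.
Qed.

Lemma lcont_on_vlines f a b c d : a <= b ->
  (forall z, on_boundary a b c d z -> ccont f z) ->
  lcont_on c d (fun y => f (b +i* y)%C - f (a +i* y)%C).
Proof.
move=> ab cf y /(on_boundary_vlines ab)[b1 b2].
by apply: lcontB; apply: ccont_vline; exact: cf.
Qed.

Section OnRectangle.
Variables a b c d : R.
Hypotheses (ab : a <= b) (cd : c <= d).

Let cont f := forall z, in_rect a b c d z -> ccont f z.
Let bcont f := forall z, on_boundary a b c d z -> ccont f z.

Let cont_bcont f : cont f -> bcont f.
Proof. by move=> cf z /andP[+ _]; exact: cf. Qed.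

Lemma eq_oint f g : (forall z, on_boundary a b c d z -> f z = g z) ->
  oint f a b c d = oint g a b c d.
Proof.
move=> fg; congr (_ + _ * _); apply: eq_cint => t.
  by move=> /(on_boundary_hlines cd)[b1 b2]; rewrite !fg.
by move=> /(on_boundary_vlines ab)[b1 b2]; rewrite !fg.
Qed.

Lemma ointD f g : bcont f -> bcont g ->
  oint (fun z => f z + g z) a b c d = oint f a b c d + oint g a b c d.
Proof.
move=> cf cg; rewrite /oint.
rewrite (eq_cint (k := fun x =>
  (f (x +i* c)%C - f (x +i* d)%C) + (g (x +i* c)%C - g (x +i* d)%C))); last first.
  by move=> x _; ring.
rewrite cintD; try exact: lcont_on_hlines.
rewrite (eq_cint (a := c) (k := fun y =>
  (f (b +i* y)%C - f (a +i* y)%C) + (g (b +i* y)%C - g (a +i* y)%C))); last first.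
  by move=> x _; ring.
by rewrite (@cintD _ _ _ c d); try exact: lcont_on_vlines; ring.
Qed.

Lemma ointZ (l : C) f : bcont f ->
  oint (fun z => l * f z) a b c d = l * oint f a b c d.
Proof.
move=> cf; rewrite /oint.
rewrite (eq_cint (k := fun x => l * (f (x +i* c)%C - f (x +i* d)%C))); last first.
  by move=> x _; ring.
rewrite cintZ; try exact: lcont_on_hlines.
rewrite (eq_cint (a := c) (k := fun y => l * (f (b +i* y)%C - f (a +i* y)%C))); last first.
  by move=> x _; ring.
by rewrite cintZ; try exact: lcont_on_vlines; ring.
Qed.

(** The difference between opposite sides is constant: [q i (c - d)] for the horizontal ones and
    [q (b - a)] for the vertical ones, so the two contributions cancel. *)
Lemma oint_affine (p q : C) : oint (fun z => p + q * z) a b c d = 0.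
Proof.
rewrite /oint (eq_cint (k := fun=> q * (0 +i* (c - d))%C)); last first.
  by move=> x _; apply: ReIm_inj; rewrite !(ReM, ImM, ReB, ImB, ReD, ImD) /=; ring.
rewrite (eq_cint (a := c) (k := fun=> q * ((b - a) +i* 0)%C)); last first.
  by move=> x _; apply: ReIm_inj; rewrite !(ReM, ImM, ReB, ImB, ReD, ImD) /=; ring.
rewrite !cint_cst //.
by apply: ReIm_inj; rewrite !(ReM, ImM, ReB, ImB, ReD, ImD) /=; ring.
Qed.

Lemma oint_le f M : bcont f ->
  (forall z, on_boundary a b c d z -> cabs (f z) <= M) ->
  cabs (oint f a b c d) <= 4 * M * (b - a + (d - c)).
Proof.
move=> cf fM; have -> : 4 * M * (b - a + (d - c)) =
  2 * (M + M) * (b - a) + 2 * (M + M) * (d - c) by ring.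
apply: (le_trans (cabsD _ _)); rewrite cabsM cabs_i mul1r.
apply: lerD; apply: cint_le => //; try exact: lcont_on_hlines;
  try exact: lcont_on_vlines.
- move=> x /(on_boundary_hlines cd)[b1 b2].
  by apply: (le_trans (cabsB _ _)); apply: lerD; exact: fM.
- move=> x /(on_boundary_vlines ab)[b1 b2].
  by apply: (le_trans (cabsB _ _)); apply: lerD; exact: fM.
Qed.

Lemma oint_vsplit m f : a <= m -> m <= b -> cont f ->
  oint f a b c d = oint f a m c d + oint f m b c d.
Proof.
move=> am mb cf; rewrite /oint (cint_split am mb); last by apply: lcont_on_hlines => //; exact: cont_bcont.
rewrite (eq_cint (a := c) (k := fun y =>
  (f (m +i* y)%C - f (a +i* y)%C) + (f (b +i* y)%C - f (m +i* y)%C))); last first.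
  by move=> x _; ring.
rewrite (@cintD _ _ _ c d); first by ring.
- apply: lcont_on_vlines => // z /andP[/andP[/andP[z1 z2] z3] _]; apply: cf.
  by rewrite /in_rect z1 (le_trans z2 mb).
- apply: lcont_on_vlines => // z /andP[/andP[/andP[z1 z2] z3] _]; apply: cf.
  by rewrite /in_rect (le_trans am z1) z2.
Qed.

Lemma oint_hsplit m f : c <= m -> m <= d -> cont f ->
  oint f a b c d = oint f a b c m + oint f a b m d.
Proof.
move=> cm md cf; rewrite /oint.
rewrite (cint_split (h := fun y => f (b +i* y)%C - f (a +i* y)%C) cm md);
  last by apply: lcont_on_vlines => //; exact: cont_bcont.
rewrite (eq_cint (a := a) (k := fun x =>
  (f (x +i* c)%C - f (x +i* m)%C) + (f (x +i* m)%C - f (x +i* d)%C))); last first.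
  by move=> x _; ring.
rewrite cintD; first by ring.
- apply: lcont_on_hlines => // z /andP[/andP[z3 /andP[z1 z2]] _]; apply: cf.
  by rewrite /in_rect z3 z1 (le_trans z2 md).
- apply: lcont_on_hlines => // z /andP[/andP[z3 /andP[z1 z2]] _]; apply: cf.
  by rewrite /in_rect z3 (le_trans cm z1) z2.
Qed.

End OnRectangle.

Lemma exists_pow2_lt (L e : R) : 0 < e -> exists n, L / 2 ^+ n < e.
Proof.
move=> e0; exists (Num.bound (`|L| / e)).
set n := Num.bound _.
have p0 : (0 : R) < 2 ^+ n by rewrite exprn_gt0.
rewrite ltr_pdivrMr //.
have : `|L| / e < n%:R by apply: archi_boundP; rewrite divr_ge0 // ltW.
rewrite ltr_pdivrMr // => h.
apply: (le_lt_trans (ler_norm L)); apply: (lt_le_trans h).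
rewrite mulrC ler_pM2l // -natrX ler_nat; exact/ltnW/ltn_expl.
Qed.

Lemma nested_segments (u v : nat -> R) :
  (forall n, u n <= u n.+1) -> (forall n, v n.+1 <= v n) ->
  (forall n, u n <= v n) -> exists x, forall n, u n <= x <= v n.
Proof.
move=> hu hv uv.
have mu m n : (m <= n)%N -> u m <= u n by exact: (homo_leq (@lexx _ R) (@le_trans _ R)).
have mv m n : (m <= n)%N -> v n <= v m.
  by apply: (@homo_leq _ v (fun x y => y <= x)) => // y x z yx zy; exact: le_trans zy yx.
have uvmn m n : u m <= v n.
  apply: (@le_trans _ _ (u (maxn m n))); first by rewrite mu ?leq_maxl.
  by apply: (le_trans (uv _)); rewrite mv ?leq_maxr.
exists (sup (range u)) => n; apply/andP; split.
  apply: ub_le_sup; last by exists n.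
  by exists (v 0%N) => _ [m _ <-].
by apply: ge_sup; [exists (u 0%N); exists 0%N|move=> _ [m _ <-]].
Qed.

(** Compactness of a rectangle as an induction principle. If [P] failed, it would fail on one of the
    four quarters, and so on; the nested bad rectangles shrink to a point, near which [P] holds by
    the local hypothesis. It serves both Goursat's theorem and the boundedness of continuous
    functions. *)
Lemma rect_bisection (P : R -> R -> R -> R -> Prop) a0 b0 c0 d0 :
  (forall a b c d, a <= b -> c <= d ->
    P a ((a + b) / 2) c ((c + d) / 2) -> P ((a + b) / 2) b c ((c + d) / 2) ->
    P a ((a + b) / 2) ((c + d) / 2) d -> P ((a + b) / 2) b ((c + d) / 2) d ->
    P a b c d) ->
  a0 <= b0 -> c0 <= d0 ->
  (forall z, in_rect a0 b0 c0 d0 z -> exists2 e : R, 0 < e &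
    forall a b c d, a <= b -> c <= d -> in_rect a b c d z ->
      b - a < e -> d - c < e -> P a b c d) ->
  P a0 b0 c0 d0.
Proof.
move=> Psplit ab0 cd0 Ploc; apply: contrapT => nP.
pose bad (q : R * R * (R * R)) :=
  [/\ q.1.1 <= q.1.2, q.2.1 <= q.2.2 & ~ P q.1.1 q.1.2 q.2.1 q.2.2].
pose child (q q' : R * R * (R * R)) :=
  [/\ q.1.1 <= q'.1.1, q'.1.2 <= q.1.2, q.2.1 <= q'.2.1 & q'.2.2 <= q.2.2] /\
  (q'.1.2 - q'.1.1 = (q.1.2 - q.1.1) / 2 /\ q'.2.2 - q'.2.1 = (q.2.2 - q.2.1) / 2).
have step (q : {q | bad q}) : exists q' : {q | bad q}, child (sval q) (sval q').
  case: q => [[[a b] [c d]] /= [/= ab cd nPq]].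
  have [a1 a2] : a <= (a + b) / 2 /\ (a + b) / 2 <= b by split; lra.
  have [c1 c2] : c <= (c + d) / 2 /\ (c + d) / 2 <= d by split; lra.
  have [p1|p1] := pselect (P a ((a + b) / 2) c ((c + d) / 2)); last first.
    by exists (exist bad ((a, (a + b) / 2), (c, (c + d) / 2)) (And3 a1 c1 p1)); split; split => //=; lra.
  have [p2|p2] := pselect (P ((a + b) / 2) b c ((c + d) / 2)); last first.
    by exists (exist bad (((a + b) / 2, b), (c, (c + d) / 2)) (And3 a2 c1 p2)); split; split => //=; lra.
  have [p3|p3] := pselect (P a ((a + b) / 2) ((c + d) / 2) d); last first.
    by exists (exist bad ((a, (a + b) / 2), ((c + d) / 2, d)) (And3 a1 c2 p3)); split; split => //=; lra.
  have [p4|p4] := pselect (P ((a + b) / 2) b ((c + d) / 2) d); last first.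
    by exists (exist bad (((a + b) / 2, b), ((c + d) / 2, d)) (And3 a2 c2 p4)); split; split => //=; lra.
  by case: nPq; exact: Psplit.
have [F HF] := choice step.
have b00 : bad ((a0, b0), (c0, d0)) by [].
pose s n := sval (iter n F (exist bad _ b00)).
have sbad n : bad (s n) by exact: (svalP (iter n F (exist bad _ b00))).
have schild n : child (s n) (s n.+1) by exact: HF.
have [x Hx] : exists x, forall n, (s n).1.1 <= x <= (s n).1.2.
  apply: nested_segments => n; first by have [[]] := schild n.
    by have [[]] := schild n.
  by have [] := sbad n.
have [y Hy] : exists y, forall n, (s n).2.1 <= y <= (s n).2.2.
  apply: nested_segments => n; first by have [[]] := schild n.
    by have [[]] := schild n.
  by have [] := sbad n.
have len n : (s n).1.2 - (s n).1.1 = (b0 - a0) / 2 ^+ n /\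
             (s n).2.2 - (s n).2.1 = (d0 - c0) / 2 ^+ n.
  elim: n => [|n [IH1 IH2]]; first by rewrite expr0 !divr1.
  have [_ [-> ->]] := schild n.
  by rewrite IH1 IH2 exprSr invfM; split; ring.
have [|e e0 He] := Ploc (x +i* y)%C.
  by rewrite /in_rect (Hx 0%N) (Hy 0%N).
have [n Hn] := @exists_pow2_lt (Num.max (b0 - a0) (d0 - c0)) _ e0.
have p0 : (0 : R) < 2 ^+ n by rewrite exprn_gt0.
have [l1 l2] := len n.
have [h1 h2 h3] := sbad n; apply: h3; apply: He => //.
- by rewrite /in_rect /= Hx Hy.
- by rewrite l1; apply: le_lt_trans Hn; rewrite ler_pM2r ?invr_gt0 // le_max lexx.
- by rewrite l2; apply: le_lt_trans Hn; rewrite ler_pM2r ?invr_gt0 // le_max lexx orbT.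
Qed.

Lemma cabs_in_rect_le a b c d (z w : C) : in_rect a b c d z ->
  in_rect a b c d w -> cabs (w - z) <= b - a + (d - c).
Proof.
move=> /andP[/andP[z1 z2] /andP[z3 z4]] /andP[/andP[w1 w2] /andP[w3 w4]].
apply: (le_trans (cabs_le_ReIm _)); rewrite ReB ImB.
by apply: lerD; rewrite ler_norml; apply/andP; split; lra.
Qed.

(** The bound [e * (half-perimeter)^2] is suited to bisection: each quarter has half the
    half-perimeter, so four quarter bounds add up to the bound for the whole. Since [e] is
    arbitrary, the integral vanishes. *)
Lemma goursat f a0 b0 c0 d0 : a0 <= b0 -> c0 <= d0 ->
  (forall z, in_rect a0 b0 c0 d0 z -> cdiff f z) -> oint f a0 b0 c0 d0 = 0.
Proof.
move=> ab0 cd0 df; apply/eqP; rewrite -cabs_eq0 eq_le cabs_ge0 andbT.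
have sub a b c d z : a0 <= a -> b <= b0 -> c0 <= c -> d <= d0 ->
    in_rect a b c d z -> in_rect a0 b0 c0 d0 z.
  move=> h1 h2 h3 h4 /andP[/andP[z1 z2] /andP[z3 z4]].
  by rewrite /in_rect (le_trans h1) // (le_trans z2) // (le_trans h3) // (le_trans z4).
have key e : 0 < e -> cabs (oint f a0 b0 c0 d0) <= e * (b0 - a0 + (d0 - c0)) ^+ 2.
  move=> e0; pose P a b c d := a0 <= a -> b <= b0 -> c0 <= c -> d <= d0 ->
    cabs (oint f a b c d) <= e * (b - a + (d - c)) ^+ 2.
  suff : P a0 b0 c0 d0 by apply.
  apply: rect_bisection => //.
    move=> a b c d ab cd P1 P2 P3 P4 h1 h2 h3 h4.
    have [a1 a2] : a <= (a + b) / 2 /\ (a + b) / 2 <= b by split; lra.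
    have [c1 c2] : c <= (c + d) / 2 /\ (c + d) / 2 <= d by split; lra.
    have cf z : in_rect a b c d z -> ccont f z.
      by move=> /(sub _ _ _ _ _ h1 h2 h3 h4) /df; exact: cdiff_ccont.
    rewrite (oint_vsplit cd a1 a2 cf).
    rewrite (oint_hsplit a1 c1 c2); last first.
      move=> z /andP[/andP[z1 z2] z3]; apply: cf.
      by rewrite /in_rect z3 z1 (le_trans z2).
    rewrite (oint_hsplit a2 c1 c2); last first.
      move=> z /andP[/andP[z1 z2] z3]; apply: cf.
      by rewrite /in_rect z3 z2 (le_trans a1).
    have q1 : cabs (oint f a ((a + b) / 2) c ((c + d) / 2)) <=
      e * ((b - a + (d - c)) / 2) ^+ 2.
      by apply: (le_trans (P1 _ _ _ _)); try lra; rewrite le_eqVlt; apply/orP; left; apply/eqP; field.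
    have q2 : cabs (oint f ((a + b) / 2) b c ((c + d) / 2)) <=
      e * ((b - a + (d - c)) / 2) ^+ 2.
      by apply: (le_trans (P2 _ _ _ _)); try lra; rewrite le_eqVlt; apply/orP; left; apply/eqP; field.
    have q3 : cabs (oint f a ((a + b) / 2) ((c + d) / 2) d) <=
      e * ((b - a + (d - c)) / 2) ^+ 2.
      by apply: (le_trans (P3 _ _ _ _)); try lra; rewrite le_eqVlt; apply/orP; left; apply/eqP; field.
    have q4 : cabs (oint f ((a + b) / 2) b ((c + d) / 2) d) <=
      e * ((b - a + (d - c)) / 2) ^+ 2.
      by apply: (le_trans (P4 _ _ _ _)); try lra; rewrite le_eqVlt; apply/orP; left; apply/eqP; field.
    have -> : e * (b - a + (d - c)) ^+ 2 =
      (e * ((b - a + (d - c)) / 2) ^+ 2 + e * ((b - a + (d - c)) / 2) ^+ 2) +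
      (e * ((b - a + (d - c)) / 2) ^+ 2 + e * ((b - a + (d - c)) / 2) ^+ 2) by field.
    apply: (le_trans (cabsD _ _)); apply: lerD;
      by apply: (le_trans (cabsD _ _)); apply: lerD.
  move=> z /df [g cg [r r0 fE]].
  (* [oint_le] costs a factor 4. Sides shorter than [m / 2] keep the half-perimeter, which bounds
     [|w - z|], below [m]. *)
  have e4 : 0 < e / 4 by rewrite divr_gt0.
  have [r' r'0 gE] := cg _ e4.
  pose m := Num.min r r'.
  have m0 : 0 < m by rewrite lt_min r0.
  exists (m / 2); first by rewrite divr_gt0.
  move=> a b c d ab cd zR ba dc h1 h2 h3 h4.
  have cf w : in_rect a b c d w -> ccont f w.
    by move=> /(sub _ _ _ _ _ h1 h2 h3 h4) /df; exact: cdiff_ccont.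
  (* [p + q w] is the first-order expansion of [f] at [z]. Its integral is zero, and subtracting it
     leaves [(g w - g z) (w - z)], which is small to second order. *)
  pose p := f z - g z * z; pose q := g z.
  have ca w : ccont (fun w => p + q * w) w.
    apply: ccontD; first exact: ccont_cst.
    by apply: ccontM; [exact: ccont_cst|exact: ccont_id].
  have cr w : in_rect a b c d w -> ccont (fun w => f w + (-1) * (p + q * w)) w.
    move=> wR; apply: ccontD; first exact: cf.
    by apply: ccontM; [exact: ccont_cst|exact: ca].
  have -> : oint f a b c d = oint (fun w => f w + (-1) * (p + q * w)) a b c d.
    rewrite ointD //.
    - by rewrite ointZ // ?oint_affine // ?mulr0 ?addr0.
    - by move=> w /andP[+ _]; exact: cf.
    - move=> w _; apply: ccontM; [exact: ccont_cst|exact: ca].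
  have -> : e * (b - a + (d - c)) ^+ 2 =
    4 * (e / 4 * (b - a + (d - c))) * (b - a + (d - c)) by field.
  apply: oint_le => // w /andP[wR _]; first exact: cr.
  have wz : cabs (w - z) <= b - a + (d - c) by exact: cabs_in_rect_le.
  have wm : cabs (w - z) < m by lra.
  have -> : f w + (-1) * (p + q * w) = (g w - g z) * (w - z).
    rewrite fE; first by rewrite /p /q; ring.
    by apply: (lt_le_trans wm); rewrite ge_min lexx.
  rewrite cabsM; apply: ler_pM; rewrite ?cabs_ge0 //.
  by apply: ltW; apply: gE; apply: (lt_le_trans wm); rewrite ge_min lexx orbT.
apply/ler_addgt0Pr => e e0; rewrite add0r.
set L := b0 - a0 + (d0 - c0).
have L0 : 0 <= L by rewrite addr_ge0 ?subr_ge0.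
have L1 : 0 < L ^+ 2 + 1 by rewrite ltr_wpDl // exprn_ge0.
have eL : 0 < e / (L ^+ 2 + 1) by rewrite divr_gt0.
apply: (le_trans (key _ eL)).
by rewrite mulrAC ler_pdivrMr // ler_pM2l // lerDl.
Qed.

End RectangleIntegral.

(** * Cauchy's estimate, the maximum principle and Lipschitz estimates *)

Section MaximumPrinciple.
Variable R : realType.
Local Notation C := R[i].
Implicit Types (f g F : C -> C) (a b c d x y : R) (z w : C).

Definition in_rect_interior a b c d z :=
  (a < complex.Re z < b) && (c < complex.Im z < d).

Lemma in_rect_interiorW a b c d z : in_rect_interior a b c d z -> in_rect a b c d z.
Proof.
by move=> /andP[/andP[z1 z2] /andP[z3 z4]]; rewrite /in_rect !ltW.
Qed.

Lemma in_rect_cases a b c d z : in_rect a b c d z ->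
  on_boundary a b c d z \/ in_rect_interior a b c d z.
Proof.
move=> zR; have [zB|] := boolP (on_boundary a b c d z); first by left.
rewrite /on_boundary zR /= !negb_or => /and4P[n1 n2 n3 n4]; right.
case/andP: zR => /andP[z1 z2] /andP[z3 z4].
by rewrite /in_rect_interior !lt_neqAle z1 z2 z3 z4 n2 n4 !(eq_sym _ (complex.Re z)) !(eq_sym _ (complex.Im z)) n1 n3.
Qed.

Lemma on_boundary_dist a b c d w (r : R) z :
  a + r <= complex.Re w <= b - r -> c + r <= complex.Im w <= d - r ->
  on_boundary a b c d z -> r <= cabs (z - w).
Proof.
move=> /andP[w1 w2] /andP[w3 w4] /andP[_ /or4P[] /eqP E].
- apply: le_trans (normr_Re_le_cabs _); rewrite ReB E ler_normr; lra.
- apply: le_trans (normr_Re_le_cabs _); rewrite ReB E ler_normr; lra.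
- apply: le_trans (normr_Im_le_cabs _); rewrite ImB E ler_normr; lra.
- apply: le_trans (normr_Im_le_cabs _); rewrite ImB E ler_normr; lra.
Qed.

Lemma interior_room a b c d w : in_rect_interior a b c d w ->
  exists2 r : R, 0 < r &
    (a + r <= complex.Re w <= b - r) /\ (c + r <= complex.Im w <= d - r).
Proof.
move=> /andP[/andP[w1 w2] /andP[w3 w4]].
pose r := Num.min (Num.min (complex.Re w - a) (b - complex.Re w))
                  (Num.min (complex.Im w - c) (d - complex.Im w)).
have r1 : r <= complex.Re w - a by rewrite /r !ge_min lexx.
have r2 : r <= b - complex.Re w by rewrite /r !ge_min lexx orbT.
have r3 : r <= complex.Im w - c by rewrite /r !ge_min lexx !orbT.
have r4 : r <= d - complex.Im w by rewrite /r !ge_min lexx !orbT.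
exists r; first by rewrite /r !lt_min !subr_gt0 w1 w2 w3 w4.
by split; apply/andP; split; lra.
Qed.

Lemma in_rect_sub a b c d a' b' c' d' z : a <= a' -> b' <= b -> c <= c' ->
  d' <= d -> in_rect a' b' c' d' z -> in_rect a b c d z.
Proof.
move=> h1 h2 h3 h4 /andP[/andP[z1 z2] /andP[z3 z4]].
by rewrite /in_rect (le_trans h1) // (le_trans z2) // (le_trans h3) // (le_trans z4).
Qed.

(** Four cuts isolate a square of half-side [e] around [w]. The four outer rectangles avoid [w] and
    contribute nothing; on the square [g] is bounded by [M], so its contribution is at most
    [16 M e], and [e] is arbitrary. *)
Lemma goursat_punctured g a b c d w : in_rect_interior a b c d w ->
  (forall z, in_rect a b c d z -> ccont g z) ->
  (forall z, in_rect a b c d z -> z != w -> cdiff g z) ->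
  oint g a b c d = 0.
Proof.
move=> wi cg dg; have [r r0 [/andP[w1 w2] /andP[w3 w4]]] := interior_room wi.
apply/eqP; rewrite -cabs_eq0 eq_le cabs_ge0 andbT.
have [d0 d00 gd] := cg _ (in_rect_interiorW wi) _ ltr01.
set M := cabs (g w) + 1; have M0 : 0 < M by rewrite ltr_wpDl // cabs_ge0.
have key e : 0 < e -> e <= r -> 2 * e < d0 ->
    cabs (oint g a b c d) <= 16 * M * e.
  move=> e0 er ed.
  pose x1 := complex.Re w - e; pose x2 := complex.Re w + e.
  pose y1 := complex.Im w - e; pose y2 := complex.Im w + e.
  have [ax1 x12 x2b] : [/\ a <= x1, x1 <= x2 & x2 <= b].
    by rewrite /x1 /x2; split; lra.
  have [cy1 y12 y2d] : [/\ c <= y1, y1 <= y2 & y2 <= d].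
    by rewrite /y1 /y2; split; lra.
  have [x1b ax2] : x1 <= b /\ a <= x2 by split; lra.
  have [y1d cy2] : y1 <= d /\ c <= y2 by split; lra.
  have cd : c <= d by lra.
  have out a' b' c' d' : a' <= b' -> c' <= d' ->
      a <= a' -> b' <= b -> c <= c' -> d' <= d ->
      ~~ in_rect a' b' c' d' w -> oint g a' b' c' d' = 0.
    move=> ab' cd' h1 h2 h3 h4 nw; apply: goursat => // z zR.
    apply: dg; first exact: in_rect_sub zR.
    by apply: contraNneq nw => <-.
  rewrite (oint_vsplit cd ax1 x1b cg) out //; last first.
    by rewrite /in_rect !negb_and -!ltNge; apply/orP; left; rewrite /x1; apply/orP; right; lra.
  rewrite add0r (oint_vsplit cd x12 x2b); last first.
    by move=> z /(in_rect_sub ax1 (lexx b) (lexx c) (lexx d)); exact: cg.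
  rewrite [X in _ + X]out //; last first.
    by rewrite /in_rect !negb_and -!ltNge; apply/orP; left; rewrite /x2; apply/orP; left; lra.
  rewrite addr0 (oint_hsplit x12 cy1 y1d); last first.
    by move=> z /(in_rect_sub ax1 x2b (lexx c) (lexx d)); exact: cg.
  rewrite out //; last first.
    by rewrite /in_rect !negb_and -!ltNge; apply/orP; right; rewrite /y1; apply/orP; right; lra.
  rewrite add0r (oint_hsplit x12 y12 y2d); last first.
    by move=> z /(in_rect_sub ax1 x2b cy1 (lexx d)); exact: cg.
  rewrite [X in _ + X]out //; last first.
    by rewrite /in_rect !negb_and -!ltNge; apply/orP; right; rewrite /y2; apply/orP; left; lra.
  rewrite addr0.
  have -> : 16 * M * e = 4 * M * (x2 - x1 + (y2 - y1)).
    by rewrite /x1 /x2 /y1 /y2; ring.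
  apply: oint_le => // z /andP[zR _].
    by apply: cg; exact: in_rect_sub zR.
  have /gd : cabs (z - w) < d0.
    apply: le_lt_trans ed; apply: (le_trans (cabs_le_ReIm _)).
    rewrite ReB ImB; case/andP: zR => /andP[z1 z2] /andP[z3 z4].
    have -> : 2 * e = e + e by ring.
    by apply: lerD; rewrite ler_norml; apply/andP; split; rewrite /x1 /x2 /y1 /y2 in z1 z2 z3 z4; lra.
  move=> gz; have -> : g z = g w + (g z - g w) by ring.
  by apply: (le_trans (cabsD _ _)); rewrite lerD2l ltW.
apply/ler_addgt0Pr => e e0; rewrite add0r.
have M16 : 0 < 16 * M by rewrite mulr_gt0.
pose s := Num.min (Num.min r (d0 / 4)) (e / (16 * M)).
have s0 : 0 < s by rewrite !lt_min r0 !divr_gt0.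
have s1 : s <= r by rewrite !ge_min lexx.
have s2 : s <= d0 / 4 by rewrite !ge_min lexx orbT.
have s3 : s <= e / (16 * M) by rewrite !ge_min lexx orbT.
apply: (le_trans (key s s0 s1 _)); first by lra.
by rewrite mulrC -ler_pdivlMr.
Qed.

Lemma ccont_invB w z : z != w -> ccont (fun z => (z - w)^-1) z.
Proof. by move=> /cdiff_invB /cdiff_ccont. Qed.

Lemma Re_inv z : complex.Re z^-1 = complex.Re z / (complex.Re z ^+ 2 + complex.Im z ^+ 2).
Proof. by case: z. Qed.

Lemma Im_inv z : complex.Im z^-1 = - complex.Im z / (complex.Re z ^+ 2 + complex.Im z ^+ 2).
Proof. by case: z => x y /=; rewrite mulNr. Qed.

Lemma on_boundary_neq a b c d w z : in_rect_interior a b c d w ->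
  on_boundary a b c d z -> z != w.
Proof.
move=> /andP[/andP[w1 w2] /andP[w3 w4]] /andP[_ zb].
apply: contraTneq zb => ->.
by rewrite !negb_or (gt_eqF w1) (lt_eqF w2) (gt_eqF w3) (lt_eqF w4).
Qed.

(** The imaginary part of the integral is positive: as [w] lies inside, all four sides contribute
    nonnegatively, and the top side strictly so. *)
Lemma oint_cauchy_kernel_neq0 a b c d w : in_rect_interior a b c d w ->
  oint (fun z => (z - w)^-1) a b c d != 0.
Proof.
move=> wi; have nz z := @on_boundary_neq _ _ _ _ _ z wi.
have /andP[/andP[w1 w2] /andP[w3 w4]] := wi.
have [ab cd] : a <= b /\ c <= d by split; lra.
apply/eqP => /(congr1 (@complex.Im R)); rewrite /oint ImD ImM /= mul0r mul1r add0r.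
move=> E.
(* The squared diagonal bounds the squared distance from [w] to any point of the top side. *)
pose D := (b - a) ^+ 2 + (d - c) ^+ 2.
have D0 : 0 < D by rewrite ltr_wpDr ?sqr_ge0 // exprn_gt0 // subr_gt0; lra.
have bc z : on_boundary a b c d z -> ccont (fun z => (z - w)^-1) z.
  by move=> /nz; exact: ccont_invB.
have h1 : (d - complex.Im w) / D * (b - a) <= Rintegral (@lebesgue_measure R) `[a, b]
   (fun x => complex.Im (((x +i* c)%C - w)^-1 - ((x +i* d)%C - w)^-1)).
  apply: Rintegral_segment_ge => //.
    by move=> x /(lcont_on_hlines cd bc); exact: lcont_Im_continuous.
  move=> x /andP[ax xb]; rewrite ImB !Im_inv !ReB !ImB /=.
  set P := (x - complex.Re w) ^+ 2.
  have P0 : 0 <= P by rewrite sqr_ge0.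
  have q1 : 0 <= - (c - complex.Im w) / (P + (c - complex.Im w) ^+ 2).
    by rewrite divr_ge0 ?subr_ge0 ?addr_ge0 ?sqr_ge0 //; lra.
  have q2 : (d - complex.Im w) / D <= (d - complex.Im w) / (P + (d - complex.Im w) ^+ 2).
    rewrite ler_pM2l ?subr_gt0 // lef_pV2 ?posrE // ?ltr_wpDl ?exprn_gt0 ?subr_gt0 //.
    apply: lerD.
      rewrite /P -(real_normK (num_real (x - complex.Re w))) ler_pXn2r ?nnegrE ?subr_ge0 //.
      by rewrite ler_norml; apply/andP; split; lra.
    by rewrite ler_pXn2r ?nnegrE //; lra.
  by rewrite mulNr in q1; rewrite !mulNr opprK; lra.
have h2 : 0 * (d - c) <= Rintegral (@lebesgue_measure R) `[c, d]
   (fun y => complex.Re (((b +i* y)%C - w)^-1 - ((a +i* y)%C - w)^-1)).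
  apply: Rintegral_segment_ge => //.
    by move=> x /(lcont_on_vlines ab bc); exact: lcont_Re_continuous.
  move=> y /andP[cy yd]; rewrite ReB !Re_inv !ReB !ImB /=.
  set P := (y - complex.Im w) ^+ 2.
  have P0 : 0 <= P by rewrite sqr_ge0.
  have q1 : 0 <= - (a - complex.Re w) / ((a - complex.Re w) ^+ 2 + P).
    by rewrite divr_ge0 ?subr_ge0 ?addr_ge0 ?sqr_ge0 //; lra.
  have q2 : 0 <= (b - complex.Re w) / ((b - complex.Re w) ^+ 2 + P).
    by rewrite divr_ge0 ?subr_ge0 ?addr_ge0 ?sqr_ge0 //; lra.
  by rewrite mulNr in q1; lra.
have : 0 < (d - complex.Im w) / D * (b - a).
  by rewrite mulr_gt0 ?divr_gt0 // subr_gt0 //; lra.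
by rewrite mul0r in h2; lra.
Qed.

(** If [x] exceeded [M], then [(M / x)^n] would tend to 0, against [1 <= K (M / x)^n]. *)
Lemma le_of_expr_le (x M K : R) : 0 <= M ->
  (forall n, x ^+ n <= K * M ^+ n) -> x <= M.
Proof.
move=> M0 H; rewrite leNgt; apply/negP => Mx.
have x0 : 0 < x by exact: le_lt_trans Mx.
have K0 : 0 <= K by have := H 0%N; rewrite !expr0 mulr1; lra.
have y1 : `|M / x| < 1.
  by rewrite ger0_norm ?divr_ge0 ?(ltW x0) // ltr_pdivrMr // mul1r.
have /cvgrPdist_lt/(_ (K + 1)^-1) := cvg_expr y1.
rewrite invr_gt0 ltr_wpDl // => /(_ isT) [n _ /(_ n (leqnn n))] /=.
rewrite sub0r normrN normrX ger0_norm ?divr_ge0 ?(ltW x0) // expr_div_n.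
have xn0 : 0 < x ^+ n by rewrite exprn_gt0.
rewrite ltr_pdivrMr // mulrC ltr_pdivlMr ?ltr_wpDl //.
have := H n; have : 0 <= M ^+ n by rewrite exprn_ge0.
by rewrite mulrDr mulr1 (mulrC K); lra.
Qed.

(** [K] depends on the rectangle and on [w] alone; this uniformity in [F] is what permits replacing
    [F] by its powers. The difference quotient of [F] at [w] integrates to zero, so [F w] times the
    integral of the kernel equals the integral of [F] against it. *)
Lemma cauchy_bound a b c d w : in_rect_interior a b c d w ->
  exists K : R, forall F M, (forall z, in_rect a b c d z -> cdiff F z) ->
    (forall z, on_boundary a b c d z -> cabs (F z) <= M) -> cabs (F w) <= K * M.
Proof.
move=> wi; have /andP[/andP[w1 w2] /andP[w3 w4]] := wi.
have [ab cd] : a <= b /\ c <= d by split; lra.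
have [r r0 [wr1 wr2]] := interior_room wi.
pose k z := (z - w)^-1.
have k0 := oint_cauchy_kernel_neq0 wi.
exists (4 * (b - a + (d - c)) / r / cabs (oint k a b c d)) => F M dF FM.
have [l cG] := cdiff_cquot_ccont (dF _ (in_rect_interiorW wi)).
have G0 : oint (cquot F w l) a b c d = 0.
  apply: (goursat_punctured wi) => z zR.
    have [->//|zw] := eqVneq z w.
    by apply: cdiff_ccont; apply: cdiff_cquot => //; exact: dF.
  by move=> zw; apply: cdiff_cquot => //; exact: dF.
have bk z : on_boundary a b c d z -> ccont k z.
  by move=> /(on_boundary_neq wi); exact: ccont_invB.
have bFk z : on_boundary a b c d z -> ccont (fun z => F z * k z) z.
  move=> zb; apply: ccontM; last exact: bk.
  by apply: cdiff_ccont; apply: dF; case/andP: zb.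
have E : oint (fun z => F z * k z) a b c d = F w * oint k a b c d.
  apply/eqP; rewrite -subr_eq0 -G0 -mulNr -ointZ // -ointD //; last first.
    by move=> z zb; apply: ccontM; [exact: ccont_cst|exact: bk].
  apply/eqP/eq_oint => // z /(on_boundary_neq wi) zw.
  by rewrite cquotE // /k; ring.
have kpos : 0 < cabs (oint k a b c d) by rewrite cabs_gt0.
rewrite mulrAC ler_pdivlMr // -cabsM -E.
have -> : 4 * (b - a + (d - c)) / r * M = 4 * (M / r) * (b - a + (d - c)) by ring.
apply: oint_le => // z zb; rewrite cabsM /k cabsV.
apply: ler_pM; rewrite ?invr_ge0 ?cabs_ge0 //; first exact: FM.
have rz := on_boundary_dist wr1 wr2 zb.
by rewrite lef_pV2 ?posrE //; exact: lt_le_trans rz.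
Qed.

(* Applying [cauchy_bound] to the powers of [F] removes its constant. *)
Lemma maximum_principle F a b c d w M : in_rect_interior a b c d w ->
  (forall z, in_rect a b c d z -> cdiff F z) ->
  (forall z, on_boundary a b c d z -> cabs (F z) <= M) -> cabs (F w) <= M.
Proof.
move=> wi dF FM; have [K HK] := cauchy_bound wi.
have M0 : 0 <= M.
  have /andP[/andP[w1 w2] /andP[w3 w4]] := wi.
  apply: le_trans (cabs_ge0 _) (FM (a +i* c)%C _).
  by rewrite /on_boundary /in_rect /= !lexx eqxx /= andbT; apply/andP; split; lra.
apply: (le_of_expr_le (K := K)) => // n; rewrite -cabsX.
apply: (HK (fun z => F z ^+ n)) => z zR; first exact/cdiffX/dF.
by rewrite cabsX lerXn2r ?nnegrE ?cabs_ge0 // FM.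
Qed.

(* The factor [z - z0] makes [(z - z0) g(z)^n] differentiable at [z0]; its effect
   vanishes as [n] grows. *)
Lemma maximum_principle_punctured g a b c d z0 w M :
  in_rect_interior a b c d w -> in_rect_interior a b c d z0 ->
  (forall z, in_rect a b c d z -> z != z0 -> cdiff g z) -> ccont g z0 ->
  (forall z, on_boundary a b c d z -> cabs (g z) <= M) -> cabs (g w) <= M.
Proof.
move=> wi z0i dg cg gM.
have M0 : 0 <= M.
  have /andP[/andP[w1 w2] /andP[w3 w4]] := wi.
  apply: le_trans (cabs_ge0 _) (gM (a +i* c)%C _).
  by rewrite /on_boundary /in_rect /= !lexx eqxx /= andbT; apply/andP; split; lra.
have main v : in_rect_interior a b c d v -> v != z0 -> cabs (g v) <= M.
  move=> vi vz; have vz0 : 0 < cabs (v - z0) by rewrite cabs_gt0 subr_eq0.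
  (* On the boundary the factor [|z - z0|] is at most the half-perimeter, and at [v] it equals
     [|v - z0|]; their ratio is the constant. *)
  apply: (le_of_expr_le (K := (b - a + (d - c)) / cabs (v - z0))) => // n.
  rewrite mulrAC ler_pdivlMr // mulrC -cabsX -cabsM.
  apply: (maximum_principle (F := fun z => (z - z0) * g z ^+ n) vi) => z.
    move=> zR; have [->|zz0] := eqVneq z z0.
      exists (fun z => g z ^+ n); first exact: ccontX.
      by exists 1 => // u _; rewrite subrr mul0r add0r mulrC.
    apply: cdiffM; first by apply: cdiffB; [exact: cdiff_id|exact: cdiff_cst].
    by apply: cdiffX; exact: dg.
  move=> zb; rewrite cabsM cabsX; apply: ler_pM; rewrite ?exprn_ge0 ?cabs_ge0 //.
    apply: cabs_in_rect_le; first exact: in_rect_interiorW.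
    by case/andP: zb.
  by rewrite lerXn2r ?nnegrE ?cabs_ge0 // gM.
(* At [z0] itself the factor vanishes and says nothing; there the bound is carried over by
   continuity from a nearby point [v]. *)
have [E|] := eqVneq w z0; last exact: main.
apply/ler_addgt0Pr => e e0.
have [dl dl0 H] := cg _ e0.
have [r r0 [/andP[w1 w2] /andP[w3 w4]]] := interior_room wi.
pose t := Num.min (r / 2) (dl / 2).
have t0 : 0 < t by rewrite lt_min !divr_gt0.
have t1 : t <= r / 2 by rewrite ge_min lexx.
have t2 : t <= dl / 2 by rewrite ge_min lexx orbT.
pose v := w + (t +i* 0)%C.
have vw : v - w = (t +i* 0)%C by rewrite /v addrAC subrr add0r.
have vwt : cabs (v - w) = t.
  by rewrite vw cabsE /= expr0n addr0 sqrtr_sqr gtr0_norm.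
have vi : in_rect_interior a b c d v.
  by rewrite /in_rect_interior /v ReD ImD /=; apply/andP; split; apply/andP; split; lra.
have vn : v != z0 by rewrite -E -subr_eq0 -cabs_gt0 vwt.
have := main v vi vn.
have : cabs (g v - g z0) < e by apply: H; rewrite -E vwt; lra.
have : cabs (g w) <= cabs (g v) + cabs (g v - g z0).
  rewrite {1}E; have {1}-> : g z0 = g v - (g v - g z0) by ring.
  exact: cabsB.
lra.
Qed.

(** The closed ball of radius [r] for the sup norm: the neighbourhood to which the maximum principle
    on rectangles applies directly. *)
Definition square z0 (r : R) z :=
  in_rect (complex.Re z0 - r) (complex.Re z0 + r)
          (complex.Im z0 - r) (complex.Im z0 + r) z.

Lemma square_cabs_le z0 r z : square z0 r z -> cabs (z - z0) <= 2 * r.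
Proof.
move=> /andP[/andP[z1 z2] /andP[z3 z4]].
apply: (le_trans (cabs_le_ReIm _)); rewrite ReB ImB.
have -> : 2 * r = r + r by ring.
by apply: lerD; rewrite ler_norml; apply/andP; split; lra.
Qed.

Lemma cabs_le_square z0 r z : cabs (z - z0) <= r -> square z0 r z.
Proof.
move=> zr; have := le_trans (normr_Re_le_cabs _) zr.
have := le_trans (normr_Im_le_cabs _) zr.
rewrite ReB ImB !ler_norml => /andP[h1 h2] /andP[h3 h4].
by apply/andP; split; apply/andP; split; lra.
Qed.

Lemma square_center z0 (r : R) : 0 <= r -> square z0 r z0.
Proof. by move=> r0; apply: cabs_le_square; rewrite subrr cabs0. Qed.

Lemma square_sub z0 r z1 s z : square z0 r z1 -> square z1 s z ->
  square z0 (r + s) z.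
Proof.
move=> /andP[/andP[h1 h2] /andP[h3 h4]] /andP[/andP[k1 k2] /andP[k3 k4]].
by apply/andP; split; apply/andP; split; lra.
Qed.

Lemma square_le z0 r s z : r <= s -> square z0 r z -> square z0 s z.
Proof.
move=> rs /andP[/andP[h1 h2] /andP[h3 h4]].
by apply/andP; split; apply/andP; split; lra.
Qed.

(** A Schwarz lemma: on the boundary the numerator is at most [2 M] and the denominator at least
    [r], and the punctured maximum principle carries the bound inside. *)
Lemma cquot_le f z0 (r M : R) l z : 0 < r ->
  (forall z, square z0 r z -> cdiff f z) ->
  (forall z, square z0 r z -> cabs (f z) <= M) ->
  ccont (cquot f z0 l) z0 -> square z0 r z ->
  cabs (cquot f z0 l z) <= 2 * M / r.
Proof.
move=> r0 df fM cq zs.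
have i0 : in_rect_interior (complex.Re z0 - r) (complex.Re z0 + r)
          (complex.Im z0 - r) (complex.Im z0 + r) z0.
  by apply/andP; split; apply/andP; split; lra.
have bd u : on_boundary (complex.Re z0 - r) (complex.Re z0 + r)
          (complex.Im z0 - r) (complex.Im z0 + r) u ->
    cabs (cquot f z0 l u) <= 2 * M / r.
  move=> ub; rewrite cquotE; last exact: on_boundary_neq ub.
  have ru : r <= cabs (u - z0).
    by apply: on_boundary_dist ub; apply/andP; split; lra.
  rewrite cabsM cabsV; apply: ler_pM; rewrite ?invr_ge0 ?cabs_ge0 //.
    have -> : 2 * M = M + M by ring.
    apply: (le_trans (cabsB _ _)); apply: lerD; apply: fM; last exact/square_center/ltW.
    by case/andP: ub.
  by rewrite lef_pV2 ?posrE //; exact: lt_le_trans ru.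
have [|zi] := in_rect_cases zs; first exact: bd.
apply: (maximum_principle_punctured zi i0) => // u us uz.
by apply: cdiff_cquot => //; exact: df.
Qed.

Lemma cdiff_lipschitz f z0 (r M : R) z : 0 < r ->
  (forall z, square z0 r z -> cdiff f z) ->
  (forall z, square z0 r z -> cabs (f z) <= M) ->
  square z0 r z -> cabs (f z - f z0) <= 2 * M / r * cabs (z - z0).
Proof.
move=> r0 df fM zs.
have [l cq] := cdiff_cquot_ccont (df _ (square_center z0 (ltW r0))).
rewrite -(cquot_mul f z0 l) cabsM ler_wpM2r ?cabs_ge0 //.
exact: (cquot_le r0 df fM).
Qed.

End MaximumPrinciple.

(** * Boundedness of point evaluations *)

Section PointEvaluation.
Variable R : realType.
Local Notation C := R[i].
Implicit Types (f : C -> C) (z w : C).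

Lemma inD_cabs z w : cabs (w - z) < 1 - cabs z -> inD w.
Proof.
rewrite /inD => wz; have -> : w = z + (w - z) by ring.
by have := cabsD z (w - z); lra.
Qed.

Lemma holomorphic_cdiff f z : holomorphic_on_D f -> inD z -> cdiff f z.
Proof.
move=> hf zD; have [l H] := hf z zD.
exists (cquot f z l); last first.
  by exists 1 => // w _; rewrite cquot_mul addrC subrK.
move=> e e0; have [d d0 Hd] := H e e0.
exists (Num.min d (1 - cabs z)); first by rewrite lt_min d0 subr_gt0.
move=> w; rewrite lt_min => /andP[wd wD].
have [->|wz] := eqVneq w z; first by rewrite subrr cabs0.
rewrite {2}/cquot eqxx cquotE //.
have E : w = z + (w - z) by ring.
rewrite {1}E; apply: Hd => //; first by rewrite subr_eq0.
by rewrite -E; exact: inD_cabs wD.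
Qed.

Lemma cdiff_holomorphic f : (forall z, inD z -> cdiff f z) -> holomorphic_on_D f.
Proof.
move=> df z /df [g cg [d d0 H]]; exists (g z) => e e0.
have [d' d'0 H'] := cg e e0.
exists (Num.min d d') => [|h h0]; first by rewrite lt_min d0.
rewrite lt_min => /andP[hd hd'] _.
have E : z + h - z = h by ring.
by rewrite H E // addrAC subrr add0r mulfK //; apply: H'; rewrite E.
Qed.

Lemma ccont_bounded f a b c d : a <= b -> c <= d ->
  (forall z, in_rect a b c d z -> ccont f z) ->
  exists M : R, forall z, in_rect a b c d z -> cabs (f z) <= M.
Proof.
move=> ab cd cf.
apply: (rect_bisection (P := fun a b c d =>
  exists M : R, forall z, in_rect a b c d z -> cabs (f z) <= M)) => //.
  move=> a1 b1 c1 d1 _ _ [M1 H1] [M2 H2] [M3 H3] [M4 H4].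
  exists (Num.max (Num.max M1 M2) (Num.max M3 M4)).
  move=> z /andP[/andP[z1 z2] /andP[z3 z4]]; rewrite !le_max.
  have [l|/ltW l] := leP (complex.Re z) ((a1 + b1) / 2);
  have [m|/ltW m] := leP (complex.Im z) ((c1 + d1) / 2).
  - by rewrite H1 // /in_rect z1 z3 l m.
  - by rewrite H3 ?orbT // /in_rect z1 z4 l m.
  - by rewrite H2 ?orbT // /in_rect z2 z3 l m.
  - by rewrite H4 ?orbT // /in_rect z2 z4 l m.
move=> z /cf /(_ _ ltr01) [e e0 H]; exists (e / 2); first by rewrite divr_gt0.
move=> a1 b1 c1 d1 ab1 cd1 zR ba dc; exists (cabs (f z) + 1) => w wR.
have -> : f w = f z + (f w - f z) by ring.
apply: (le_trans (cabsD _ _)); rewrite lerD2l; apply/ltW/H.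
by apply: (le_lt_trans (cabs_in_rect_le zR wR)); lra.
Qed.

Lemma disc_sqr : @disc R = [set p | p.1 ^+ 2 + p.2 ^+ 2 < 1].
Proof.
apply/seteqP; split => p; rewrite /disc /= /inD -[cabs _ < 1](ltr_pXn2r (_ : 0 < 2)%N) //
  ?nnegrE ?cabs_ge0 // sqr_cabs expr1n //.
Qed.

Lemma measurable_disc :
  measurable (@disc R : set (measurableTypeR R * measurableTypeR R)).
Proof.
rewrite disc_sqr.
have mf : measurable_fun setT (fun p : measurableTypeR R * measurableTypeR R => p.1 ^+ 2 + p.2 ^+ 2).
  apply: measurable_funD; apply: measurable_funX;
    [exact: measurable_fst|exact: measurable_snd].
rewrite -[X in measurable X]setTI.
have -> : [set p : R * R | p.1 ^+ 2 + p.2 ^+ 2 < 1] =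
   (fun p : R * R => p.1 ^+ 2 + p.2 ^+ 2) @^-1` `]-oo, 1[%classic.
  by apply/seteqP; split => p /=; rewrite in_itv.
exact: mf.
Qed.

Local Notation normsq u := (fun p => cabs (u (cplx p)) ^+ 2).

(** This is pi times the square of [L2norm]: the normalization of the measure is left out until the
    final norm estimate. *)
Definition energy (u : C -> C) : R := Rintegral (@leb2 R) (@disc R) (normsq u).

Lemma measurable_normsq (u : C -> C) : cmeasurable u -> measurable_fun (@disc R) (normsq u).
Proof.
move=> [m1 m2].
apply: (eq_measurable_fun (fun p => complex.Re (u (cplx p)) ^+ 2 + complex.Im (u (cplx p)) ^+ 2)).
  by move=> p _; rewrite sqr_cabs.
by apply: measurable_funD; exact: measurable_funX.
Qed.

Lemma L2_integrable_normsq (u : C -> C) : L2 u ->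
  (@leb2 R).-integrable (@disc R) (EFin \o normsq u).
Proof.
move=> [mu fu]; apply/integrableP; split.
  by apply/measurable_EFinP; exact: measurable_normsq.
apply: le_lt_trans fu; rewrite le_eqVlt; apply/orP; left; apply/eqP.
by apply: eq_integral => p _ /=; rewrite ger0_norm ?sqr_ge0.
Qed.

Lemma energyE u : L2 u ->
  (\int[@leb2 R]_(p in @disc R) (normsq u p)%:E)%E = (energy u)%:E.
Proof.
move=> /L2_integrable_normsq iu; rewrite /energy /Rintegral fineK //.
exact: (integrable_fin_num measurable_disc iu).
Qed.

Lemma energy_ge0 u : 0 <= energy u.
Proof. by apply: Rintegral_ge0 => p _; rewrite sqr_ge0. Qed.

Lemma energy_square_ge u z (t m : R) : L2 u -> 0 <= t -> 0 <= m ->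
  (forall w, square z t w -> inD w) ->
  (forall w, square z t w -> m <= cabs (u w)) ->
  m ^+ 2 * (2 * t) ^+ 2 <= energy u.
Proof.
move=> uL t0 m0 sD um; rewrite -lee_fin -energyE //.
pose S : set (measurableTypeR R * measurableTypeR R) :=
  `[complex.Re z - t, complex.Re z + t]%classic `*`
  `[complex.Im z - t, complex.Im z + t]%classic.
have SE p : S p -> square z t (cplx p).
  by rewrite /S /= !in_itv /= => -[s1 s2]; rewrite /square /in_rect /= s1 s2.
have mS : measurable S by apply: measurableX; exact: measurable_itv.
have SD : S `<=` @disc R by move=> p /SE /sD.
have muS : @leb2 R S = ((2 * t) ^+ 2)%:E.
  have I (a b : R) : a <= b -> @lebesgue_measure R `[a, b]%classic = (b - a)%:E.
    rewrite lebesgue_measure_itv /= lte_fin le_eqVlt => /predU1P[->|->//].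
    by rewrite ltxx subrr.
  apply: (etrans (product_measure1E _ _ _ _)); try exact: measurable_itv.
  have A1 : complex.Re z - t <= complex.Re z + t by lra.
  have A2 : complex.Im z - t <= complex.Im z + t by lra.
  apply: (etrans (f_equal2 *%E (I _ _ A1) (I _ _ A2))).
  by rewrite -EFinM; congr (_%:E); ring.
have mN : measurable_fun (@disc R) (fun p => (normsq u p)%:E).
  by apply/measurable_EFinP; apply: measurable_normsq; case: uL.
apply: (@le_trans _ _ (\int[@leb2 R]_(p in S) (normsq u p)%:E)%E); last first.
  apply: ge0_subset_integral => //; first exact: measurable_disc.
  by move=> p _; rewrite lee_fin sqr_ge0.
rewrite EFinM -muS -integral_cst //.
apply: ge0_le_integral => //.
- by move=> p _; rewrite lee_fin sqr_ge0.
- exact: (measurable_funS measurable_disc SD).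
- move=> p /SE /um; rewrite lee_fin => h.
  by rewrite ler_pXn2r ?nnegrE ?cabs_ge0.
Qed.

(* [sbdist z s w] is the sup-norm distance from [w] to the boundary of
   [square z s]. *)
Definition sbdist z (s : R) w :=
  s - Num.max `|complex.Re w - complex.Re z| `|complex.Im w - complex.Im z|.

Lemma sbdist_square z s u : square z s u = (0 <= sbdist z s u).
Proof.
rewrite /sbdist subr_ge0 ge_max !ler_norml /square /in_rect.
by congr (_ && _); congr (_ && _); apply/idP/idP; lra.
Qed.

Lemma sbdist_le z s u t v : square u t v -> sbdist z s u - t <= sbdist z s v.
Proof.
move=> /andP[/andP[v1 v2] /andP[v3 v4]]; rewrite /sbdist.
set A := complex.Re u - _; set B := complex.Im u - _.
suff : Num.max `|complex.Re v - complex.Re z| `|complex.Im v - complex.Im z| <=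
    Num.max `|A| `|B| + t by lra.
rewrite ge_max.
have hA : `|complex.Re v - complex.Re z| <= `|A| + t.
  have -> : complex.Re v - complex.Re z = A + (complex.Re v - complex.Re u).
    by rewrite /A; ring.
  apply: (le_trans (ler_normD _ _)); rewrite lerD2l ler_norml.
  by apply/andP; split; lra.
have hB : `|complex.Im v - complex.Im z| <= `|B| + t.
  have -> : complex.Im v - complex.Im z = B + (complex.Im v - complex.Im u).
    by rewrite /B; ring.
  apply: (le_trans (ler_normD _ _)); rewrite lerD2l ler_norml.
  by apply/andP; split; lra.
have mA : `|A| <= Num.max `|A| `|B| by rewrite le_max lexx.
have mB : `|B| <= Num.max `|A| `|B| by rewrite le_max lexx orbT.
by apply/andP; split; lra.
Qed.

(* Near a point [u] almost maximizing [|f| * sbdist], the modulus of [f] is at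
   most [4 |f u|] at scale [sbdist u], so by the Lipschitz estimate it stays above
   [|f u| / 2] on a comparable square, and the energy is at least of the order of
   [(|f u| * sbdist u)^2]. *)
Lemma point_evaluation_le f z (s : R) : holomorphic_on_D f -> L2 f -> 0 < s ->
  (forall w, square z s w -> inD w) ->
  (cabs (f z) * s / 128) ^+ 2 <= energy f.
Proof.
move=> hf fL s0 sD.
have df w : square z s w -> cdiff f w by move=> /sD; exact: holomorphic_cdiff.
have [M HM] : exists M : R, forall w, square z s w -> cabs (f w) <= M.
  by apply: ccont_bounded; [lra|lra|move=> w /df /cdiff_ccont].
pose A := [set r : R | exists2 u, square z s u & r = cabs (f u) * sbdist z s u].
have dz : sbdist z s z = s by rewrite /sbdist !subrr normr0 maxxx subr0.
have zs : square z s z by apply/square_center/ltW.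
have M0 : 0 <= M by exact: le_trans (cabs_ge0 _) (HM _ zs).
have ds u : sbdist z s u <= s by rewrite /sbdist gerBl le_max normr_ge0.
have hA : has_sup A.
  split; first by exists (cabs (f z) * s), z; rewrite ?dz.
  exists (M * s) => _ [u us ->]; apply: ler_pM; rewrite ?cabs_ge0 -?sbdist_square //.
  exact: HM.
have Aub u : square z s u -> cabs (f u) * sbdist z s u <= sup A.
  by move=> us; apply: ub_le_sup; [case: hA|exists u].
set S := sup A in Aub *.
have zS : cabs (f z) * s <= S by rewrite -{1}dz; exact: Aub.
have fs0 : 0 <= cabs (f z) * s by rewrite mulr_ge0 ?cabs_ge0 // ltW.
have [S0|S0] := leP S 0.
  have -> : cabs (f z) * s = 0 by lra.
  by rewrite mul0r expr0n energy_ge0.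
have [|_ [u us ->] Hu] := sup_adherent (_ : 0 < S / 2) hA; first by rewrite divr_gt0.
rewrite -/S in Hu.
set fu := cabs (f u) in Hu; set du := sbdist z s u in Hu.
have fd : 0 < fu * du by lra.
have du0 : 0 < du.
  have : 0 <= du by rewrite -sbdist_square.
  rewrite le_eqVlt => /predU1P[E|//]; by move: fd; rewrite -E mulr0 ltxx.
have fu0 : 0 < fu by rewrite -(pmulr_lgt0 _ du0).
have sq t v : t <= du -> square u t v -> square z s v.
  by move=> tdu /(sbdist_le z s); rewrite -/du sbdist_square; lra.
have r0 : 0 < du / 2 by rewrite divr_gt0.
have rdu : du / 2 <= du by lra.
(* Here [sbdist] is still at least [du / 2], while [|f v| * sbdist <= S < 2 fu du]; hence the factor
   4. *)
have near v : square u (du / 2) v -> cabs (f v) <= 4 * fu.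
  move=> vs; have dv := sbdist_le z s vs; rewrite -/du in dv.
  have dv0 : du / 2 <= sbdist z s v by lra.
  have := Aub v (sq _ _ rdu vs).
  have : cabs (f v) * (du / 2) <= cabs (f v) * sbdist z s v.
    by rewrite ler_wpM2l ?cabs_ge0.
  move=> h1 h2; rewrite -(ler_pM2r r0); lra.
(* The Lipschitz constant is [2 (4 fu) / (du / 2) = 16 fu / du], and [|v - u| <= du / 32] here, so
   [f] varies by at most [fu / 2]. The square has side [du / 32], which gives the energy bound
   [(fu du / 64)^2]; the last factor 2, leading to 128, comes from [fu du > S / 2]. *)
have low v : square u (du / 64) v -> fu / 2 <= cabs (f v).
  move=> vs; have vs2 : square u (du / 2) v by apply: square_le vs; lra.
  have lip := cdiff_lipschitz r0 (fun w ws => df w (sq _ _ rdu ws)) near vs2.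
  have vu := square_cabs_le vs.
  have h : cabs (f v - f u) <= fu / 2.
    apply: (le_trans lip).
    have -> : 2 * (4 * fu) / (du / 2) = 16 * fu / du by field; rewrite gt_eqF.
    rewrite mulrAC ler_pdivrMr //.
    have : fu * cabs (v - u) <= fu * (2 * (du / 64)) by rewrite ler_pM2l.
    lra.
  have : fu <= cabs (f v) + cabs (f v - f u).
    rewrite /fu; have {1}-> : f u = f v - (f v - f u) by ring.
    exact: cabsB.
  lra.
have t0 : 0 <= du / 64 by lra.
have m0 : 0 <= fu / 2 by lra.
have tdu : du / 64 <= du by lra.
have E := energy_square_ge fL t0 m0 (fun w ws => sD w (sq _ _ tdu ws)) low.
apply: le_trans E.
have -> : (fu / 2) ^+ 2 * (2 * (du / 64)) ^+ 2 = (fu * du / 64) ^+ 2 by field.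
by rewrite ler_pXn2r ?nnegrE //; lra.
Qed.

End PointEvaluation.

(** * The real inner product and orthogonal projections *)

Section RealBilinearForm.
Variable R : realType.
Local Notation C := R[i].
Implicit Types (u v w h : C -> C) (r : R).

(** Pi times the real part of [inner], the polarization of [energy]. *)
Definition bform u v : R := Rintegral (@leb2 R) (@disc R) (fun p =>
  complex.Re (u (cplx p)) * complex.Re (v (cplx p)) +
  complex.Im (u (cplx p)) * complex.Im (v (cplx p))).

Definition rlin u r v : C -> C := fun z => u z + r%:C%C * v z.

Lemma Re_rlin u r v z :
  complex.Re (rlin u r v z) = complex.Re (u z) + r * complex.Re (v z).
Proof. by rewrite /rlin ReD ReM /= mul0r subr0. Qed.

Lemma Im_rlin u r v z :
  complex.Im (rlin u r v z) = complex.Im (u z) + r * complex.Im (v z).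
Proof. by rewrite /rlin ImD ImM /= mul0r addr0. Qed.

Lemma rlinN1 u v z : rlin u (-1) v z = u z - v z.
Proof. by rewrite /rlin rmorphN1 mulN1r. Qed.

Lemma bform_energy u : bform u u = energy u.
Proof. by apply: eq_Rintegral => p _; rewrite sqr_cabs !expr2. Qed.

Lemma bformC u v : bform u v = bform v u.
Proof.
by apply: eq_Rintegral => p _; rewrite mulrC [X in _ + X]mulrC.
Qed.

Lemma ReIm_mul_le (a b c d : R) :
  `|a * c + b * d| <= (a ^+ 2 + b ^+ 2) + (c ^+ 2 + d ^+ 2).
Proof.
have : 0 <= (a - c) ^+ 2 by rewrite sqr_ge0.
have : 0 <= (b - d) ^+ 2 by rewrite sqr_ge0.
have : 0 <= (a + c) ^+ 2 by rewrite sqr_ge0.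
have : 0 <= (b + d) ^+ 2 by rewrite sqr_ge0.
have : 0 <= a ^+ 2 by rewrite sqr_ge0.
have : 0 <= b ^+ 2 by rewrite sqr_ge0.
have : 0 <= c ^+ 2 by rewrite sqr_ge0.
have : 0 <= d ^+ 2 by rewrite sqr_ge0.
by rewrite ler_norml !expr2 => *; apply/andP; split; lra.
Qed.

Lemma L2_integrable_bform u v : L2 u -> L2 v ->
  (@leb2 R).-integrable (@disc R) (EFin \o (fun p =>
  complex.Re (u (cplx p)) * complex.Re (v (cplx p)) +
  complex.Im (u (cplx p)) * complex.Im (v (cplx p)))).
Proof.
move=> uL vL; have iu := L2_integrable_normsq uL.
have iv := L2_integrable_normsq vL.
have md := @measurable_disc R.
apply: (le_integrable md _ _ (integrableD md iu iv)).
  case: uL vL => [[m1 m2] _] [[m3 m4] _]; apply/measurable_EFinP.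
  by apply: measurable_funD; exact: measurable_funM.
move=> p _ /=; rewrite lee_fin [leRHS]ger0_norm; last by rewrite addr_ge0 ?sqr_ge0.
by rewrite !sqr_cabs; exact: ReIm_mul_le.
Qed.

Lemma L2_rlin u r v : L2 u -> L2 v -> L2 (rlin u r v).
Proof.
move=> uL vL; have iu := L2_integrable_normsq uL.
have iv := L2_integrable_normsq vL.
have md := @measurable_disc R.
have mc : cmeasurable (rlin u r v).
  case: uL vL => [[m1 m2] _] [[m3 m4] _]; split.
    apply: (eq_measurable_fun (fun p => complex.Re (u (cplx p)) + r * complex.Re (v (cplx p)))).
      by move=> p _; rewrite Re_rlin.
    by apply: measurable_funD => //; exact: measurable_funM.
  apply: (eq_measurable_fun (fun p => complex.Im (u (cplx p)) + r * complex.Im (v (cplx p)))).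
    by move=> p _; rewrite Im_rlin.
  by apply: measurable_funD => //; exact: measurable_funM.
split=> //.
have ig := integrableD md (integrableZl md 2 iu) (integrableZl md (2 * r ^+ 2) iv).
suff : (@leb2 R).-integrable (@disc R) (EFin \o (fun p => cabs (rlin u r v (cplx p)) ^+ 2)).
  move=> /integrableP[_]; apply: le_lt_trans; rewrite le_eqVlt; apply/orP; left; apply/eqP.
  by apply: eq_integral => p _ /=; rewrite ger0_norm ?sqr_ge0.
apply: (le_integrable md _ _ ig).
  by apply/measurable_EFinP; exact: measurable_normsq.
move=> p _ /=; rewrite lee_fin !ger0_norm ?sqr_ge0 //; last first.
  by rewrite addr_ge0 // mulr_ge0 ?sqr_ge0 // mulr_ge0 ?sqr_ge0.
rewrite !sqr_cabs Re_rlin Im_rlin.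
set a := complex.Re (u _); set b := complex.Im (u _).
set c := complex.Re (v _); set d := complex.Im (v _).
have : 0 <= (a - r * c) ^+ 2 by rewrite sqr_ge0.
have : 0 <= (b - r * d) ^+ 2 by rewrite sqr_ge0.
lra.
Qed.

Lemma bform_rlinl u r v h : L2 u -> L2 v -> L2 h ->
  bform (rlin u r v) h = bform u h + r * bform v h.
Proof.
move=> uL vL hL; have i1 := L2_integrable_bform uL hL.
have i2 := L2_integrable_bform vL hL; have md := @measurable_disc R.
rewrite /bform -(RintegralZl r md i2) -RintegralD //.
  by apply: eq_Rintegral => p _; rewrite Re_rlin Im_rlin; ring.
exact: (integrableZl md r i2).
Qed.

Lemma bform_rlinr u r v h : L2 u -> L2 v -> L2 h ->
  bform h (rlin u r v) = bform h u + r * bform h v.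
Proof. by move=> *; rewrite bformC bform_rlinl // !(bformC h). Qed.

Lemma energy_rlin u r v : L2 u -> L2 v ->
  energy (rlin u r v) = energy u + 2 * r * bform u v + r ^+ 2 * energy v.
Proof.
move=> uL vL; rewrite -!bform_energy bform_rlinl ?bform_rlinr //; try exact: L2_rlin.
by rewrite (bformC v u); ring.
Qed.

(** Used for the Cauchy-Schwarz inequality, and again to show that a minimizing sequence is almost
    orthogonal to the subspace. *)
Lemma discriminant_le (a b c : R) : 0 <= c ->
  (forall t, 0 <= a + 2 * t * b + t ^+ 2 * c) -> b ^+ 2 <= a * c.
Proof.
move=> c0 H; move: c0; rewrite le_eqVlt => /predU1P[E|c0].
  (* With [c = 0] an affine function of [t] is nonnegative; if [b] were nonzero, the [t] below would
     give it the value -1. *)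
  rewrite -E mulr0; have [->|b0] := eqVneq b 0; first by rewrite expr0n.
  have := H (- (a + 1) / (2 * b)); rewrite -E mulr0 addr0.
  have -> : 2 * (- (a + 1) / (2 * b)) * b = - (a + 1) by field.
  lra.
have := H (- b / c).
have -> : a + 2 * (- b / c) * b + (- b / c) ^+ 2 * c = (a * c - b ^+ 2) / c.
  by field; rewrite gt_eqF.
by rewrite pmulr_lge0 ?invr_gt0 // subr_ge0.
Qed.

Lemma bform_cauchy_schwarz u v : L2 u -> L2 v ->
  bform u v ^+ 2 <= energy u * energy v.
Proof.
move=> uL vL; apply: discriminant_le; first exact: energy_ge0.
by move=> t; rewrite -energy_rlin // energy_ge0.
Qed.

Definition energy_cauchy (s : nat -> C -> C) := forall e : R, 0 < e ->
  exists N, forall m n, (N <= m)%N -> (N <= n)%N ->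
    energy (rlin (s m) (-1) (s n)) < e.

Definition energy_cvg (s : nat -> C -> C) a := forall e : R, 0 < e ->
  exists N, forall n, (N <= n)%N -> energy (rlin (s n) (-1) a) < e.

(** A real-linear space of functions rather than of classes, so a limit is determined only up to
    zero energy. The notion is applied to [A2] and to the range of the Toeplitz operator. *)
Definition complete_subspace (S : (C -> C) -> Prop) :=
  [/\ exists u, S u, forall u, S u -> L2 u,
      forall u r v, S u -> S v -> S (rlin u r v) &
      forall s, (forall n, S (s n)) -> energy_cauchy s ->
        exists2 a, S a & energy_cvg s a].

Lemma invS_lt (e : R) : 0 < e -> exists N, forall n, (N <= n)%N -> n.+1%:R^-1 < e.
Proof.
move=> e0; exists (Num.bound e^-1) => n Nn.
have h : e^-1 < n.+1%:R.
  apply: (@lt_le_trans _ _ (Num.bound e^-1)%:R).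
    by apply: archi_boundP; rewrite invr_ge0 ltW.
  by rewrite ler_nat (leq_trans Nn).
by rewrite -[e]invrK ltf_pV2 ?posrE ?invr_gt0 // ltr0n.
Qed.

(* A minimizing sequence for the distance is Cauchy by the parallelogram
   identity. *)
Lemma orthogonal_projection S u : complete_subspace S -> L2 u ->
  exists2 a, S a & forall h, S h -> bform u h = bform a h.
Proof.
move=> [[u0 Su0] SL Slin Scomp] uL.
pose A := [set x : R | exists2 a, S a & x = energy (rlin u (-1) a)].
have hA : has_inf A.
  split; first by exists (energy (rlin u (-1) u0)), u0.
  by exists 0 => _ [a _ ->]; exact: energy_ge0.
have Alb a : S a -> inf A <= energy (rlin u (-1) a).
  by move=> Sa; apply: ge_inf; [case: hA|exists a].
set D := inf A in Alb.
have /choice[s Hs] (n : nat) : exists a, S a /\ energy (rlin u (-1) a) < D + n.+1%:R^-1.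
  have [|_ [a Sa ->] Ha] := inf_adherent (_ : 0 < n.+1%:R^-1) hA.
    by rewrite invr_gt0 ltr0n.
  by exists a.
have Ss n : S (s n) by case: (Hs n).
have sL n : L2 (s n) by apply: SL.
have sD n : energy (rlin u (-1) (s n)) < D + n.+1%:R^-1 by case: (Hs n).
have cs : energy_cauchy s.
  move=> e e0; have [|N HN] := invS_lt (_ : 0 < e / 4); first by rewrite divr_gt0.
  exists N => m n Nm Nn.
  (* The midpoint of [s m] and [s n] lies in [S], so its distance to [u] has energy at least [D].
     The parallelogram identity then bounds the energy of [s m - s n] by
     [2 / (m + 1) + 2 / (n + 1) < e]. *)
  pose M := rlin (s m) (1 / 2) (rlin (s n) (-1) (s m)).
  have SM : S M by apply: (Slin) => //; exact: (Slin).
  have := Alb _ SM; have := sD m; have := sD n; have := HN _ Nm; have := HN _ Nn.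
  rewrite /M !(energy_rlin, bform_rlinr, bform_rlinl) ?bform_energy //;
    try (by apply: L2_rlin => //; exact: L2_rlin).
  rewrite (bformC (s n) (s m)).
  by move: n.+1%:R^-1 m.+1%:R^-1 => qn qm *; lra.
have [a Sa ca] := Scomp s Ss cs.
exists a => // h Sh; have [aL hL] := (SL _ Sa, SL _ Sh).
apply/eqP; rewrite -subr_eq0 -sqrf_eq0 eq_le sqr_ge0 andbT.
apply/ler_addgt0Pr => e e0; rewrite add0r.
have eh := energy_ge0 h; set E := energy h in eh.
(* This makes each of [X^2] and [Y^2] below at most [e / 4], and [(X + Y)^2 <= 2 (X^2 + Y^2)]. *)
have d0 : 0 < e / (4 * (E + 1)) by rewrite divr_gt0 // mulr_gt0 // ltr_wpDl.
have [N1 H1] := invS_lt d0; have [N2 H2] := ca _ d0.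
pose n := maxn N1 N2.
have h1 := H1 n (leq_maxl _ _); have h2 := H2 n (leq_maxr _ _).
(* Moving [s n] to [s n - t h] cannot bring the energy below [D], and [s n] is within [1 / (n + 1)]
   of [D]; the resulting quadratic in [t] is nonnegative. *)
have k1 : bform (rlin u (-1) (s n)) h ^+ 2 <= n.+1%:R^-1 * E.
  apply: discriminant_le => // t.
  have := Alb (rlin (s n) (- t) h) (Slin _ _ _ (Ss n) Sh); have := sD n.
  rewrite /E !(energy_rlin, bform_rlinr, bform_rlinl) ?bform_energy //;
    try (by apply: L2_rlin => //; exact: L2_rlin).
  by move: n.+1%:R^-1 => qn *; lra.
have k2 : bform (rlin (s n) (-1) a) h ^+ 2 <= energy (rlin (s n) (-1) a) * E.
  by apply: bform_cauchy_schwarz => //; exact: L2_rlin.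
have -> : bform u h - bform a h =
    bform (rlin u (-1) (s n)) h + bform (rlin (s n) (-1) a) h.
  by rewrite !bform_rlinl //; ring.
set X := bform _ _ in k1 *; set Y := bform _ _ in k2 *.
have : 0 <= (X - Y) ^+ 2 by rewrite sqr_ge0.
have l1 : n.+1%:R^-1 * E <= e / (4 * (E + 1)) * (E + 1).
  by apply: ler_pM => //; rewrite ?invr_ge0 ?ler0n // ?ltW // ltrDl.
have l2 : energy (rlin (s n) (-1) a) * E <= e / (4 * (E + 1)) * (E + 1).
  by apply: ler_pM => //; rewrite ?energy_ge0 // ?ltW // ltrDl.
have l3 : e / (4 * (E + 1)) * (E + 1) = e / 4.
  by field; rewrite gt_eqF // ltr_wpDl.
have := le_trans k1 l1; have := le_trans k2 l2; rewrite !l3.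
by clear; lra.
Qed.

End RealBilinearForm.

(** * Completeness of the Bergman space *)

Section BergmanComplete.
Variable R : realType.
Local Notation C := R[i].
Implicit Types (f g h : C -> C) (z w : C) (s : nat -> C -> C).

Definition ccvg (x : nat -> C) (l : C) := forall e : R, 0 < e ->
  exists N, forall n, (N <= n)%N -> cabs (x n - l) < e.

Lemma real_cauchy_cvg (x : nat -> R) :
  (forall e : R, 0 < e -> exists N, forall m n, (N <= m)%N -> (N <= n)%N ->
     `|x m - x n| < e) -> exists l : R, x @ \oo --> l.
Proof.
move=> cx; suff : cvg (x @ \oo) by move=> ?; exists (lim (x @ \oo)).
apply/cauchy_cvgP/cauchy_exP => e e0; have [N HN] := cx e e0.
by exists (x N), N => // n /= Nn; rewrite /ball /=; exact: HN.
Qed.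

Lemma complex_cauchy_cvg (x : nat -> C) :
  (forall e : R, 0 < e -> exists N, forall m n, (N <= m)%N -> (N <= n)%N ->
     cabs (x m - x n) < e) -> exists l, ccvg x l.
Proof.
move=> cx.
have [a ca] : exists a : R, (fun n => complex.Re (x n)) @ \oo --> a.
  apply: real_cauchy_cvg => e /cx[N HN]; exists N => m n Nm Nn.
  by rewrite -ReB; apply: le_lt_trans (HN _ _ Nm Nn); exact: normr_Re_le_cabs.
have [b cb] : exists b : R, (fun n => complex.Im (x n)) @ \oo --> b.
  apply: real_cauchy_cvg => e /cx[N HN]; exists N => m n Nm Nn.
  by rewrite -ImB; apply: le_lt_trans (HN _ _ Nm Nn); exact: normr_Im_le_cabs.
exists (a +i* b)%C => e e0; have e2 : 0 < e / 2 by rewrite divr_gt0.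
have /cvgrPdist_lt/(_ _ e2)[N1 _ H1] := ca.
have /cvgrPdist_lt/(_ _ e2)[N2 _ H2] := cb.
exists (maxn N1 N2) => n; rewrite geq_max => /andP[n1 n2].
apply: (le_lt_trans (cabs_le_ReIm _)); rewrite ReB ImB /=.
have := H1 n n1; have := H2 n n2; rewrite /= (distrC a) (distrC b); lra.
Qed.

Lemma ccvg_unif_le (x : nat -> C) l (e : R) N : ccvg x l ->
  (forall m n, (N <= m)%N -> (N <= n)%N -> cabs (x m - x n) <= e) ->
  forall n, (N <= n)%N -> cabs (x n - l) <= e.
Proof.
move=> cx H n Nn; apply/ler_addgt0Pr => d d0.
have [N' HN'] := cx d d0.
have h1 := H n _ Nn (leq_maxl N N'); have h2 := HN' _ (leq_maxr N N').
have -> : x n - l = (x n - x (maxn N N')) + (x (maxn N N') - l) by ring.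
by apply: (le_trans (cabsD _ _)); apply: lerD => //; exact: ltW.
Qed.

Lemma ccvg_dist_eq0 (l : C) : (forall e : R, 0 < e -> cabs l <= e) -> l = 0.
Proof.
move=> H; apply/eqP; rewrite -cabs_eq0 eq_le cabs_ge0 andbT.
by apply/ler_addgt0Pr => e e0; rewrite add0r H.
Qed.

(** The factor 2 leaves room for a square of half-side [r] around every point of the square of
    half-side [r] at [z], so point evaluations are bounded uniformly there. *)
Lemma room_in_disc z : inD z ->
  exists2 r : R, 0 < r & forall w, square z (2 * r) w -> inD w.
Proof.
move=> zD; exists ((1 - cabs z) / 8); first by rewrite divr_gt0 // subr_gt0.
move=> w /square_cabs_le wz; apply: (@inD_cabs _ z).
by move: zD; rewrite /inD; lra.
Qed.

Lemma A2_rlin f (r : R) g : A2 f -> A2 g -> A2 (rlin f r g).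
Proof.
move=> [hf fL] [hg gL]; split; last exact: L2_rlin.
apply: cdiff_holomorphic => z zD; apply: cdiffD; first exact: holomorphic_cdiff.
by apply: cdiffM; [exact: cdiff_cst|exact: holomorphic_cdiff].
Qed.

Lemma A2_muli f : A2 f -> A2 (fun z => 'i%C * f z).
Proof.
move=> [hf [[m1 m2] fL]]; split.
  apply: cdiff_holomorphic => z zD.
  by apply: cdiffM; [exact: cdiff_cst|exact: holomorphic_cdiff].
split; first split.
- apply: (eq_measurable_fun (fun p => (-1) * complex.Im (f (cplx p)))).
    by move=> p _; rewrite ReM /= mul0r mul1r sub0r mulN1r.
  exact: measurable_funM.
- apply: (eq_measurable_fun (fun p => complex.Re (f (cplx p)))) => //.
  by move=> p _; rewrite ImM /= mul0r mul1r add0r.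
- apply: le_lt_trans fL; rewrite le_eqVlt; apply/orP; left; apply/eqP.
  by apply: eq_integral => p _ /=; rewrite cabsM cabs_i mul1r.
Qed.

Lemma A2_0 : A2 (fun=> 0 : C).
Proof.
split; first by apply: cdiff_holomorphic => z _; exact: cdiff_cst.
split; first by split; exact: measurable_cst.
apply: (@le_lt_trans _ _ (\int[@leb2 R]_(p in @disc R) cst 0%E p)%E).
  rewrite le_eqVlt; apply/orP; left; apply/eqP.
  by apply: eq_integral => p _ /=; rewrite cabs0 expr0n.
by rewrite integral_cst ?mul0e //; exact: measurable_disc.
Qed.

(** All evaluations at points of the smaller square share the constant [128 / r], which turns
    smallness in energy into uniform smallness. *)
Lemma A2_unif_cauchy s z (r e : R) : (forall n, A2 (s n)) -> energy_cauchy s ->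
  0 < r -> 0 < e -> (forall w, square z (2 * r) w -> inD w) ->
  exists N, forall m n w, (N <= m)%N -> (N <= n)%N -> square z r w ->
    cabs (s m w - s n w) <= e.
Proof.
move=> sA cs r0 e0 sD.
have d0 : 0 < (e * r / 128) ^+ 2 by rewrite exprn_gt0 // divr_gt0 // mulr_gt0.
have [N HN] := cs _ d0; exists N => m n w Nm Nn wz.
have [hf fL] := A2_rlin (-1) (sA m) (sA n).
have ws v : square w r v -> inD v.
  by move=> /(square_sub wz); rewrite -mulr2n -mulr_natl => /sD.
have := point_evaluation_le hf fL r0 ws.
rewrite rlinN1 => h; have := le_lt_trans h (HN m n Nm Nn).
have g0 x : 0 <= x -> 0 <= x * r / 128 by move=> x0; rewrite divr_ge0 // mulr_ge0 // ltW.
rewrite ltr_pXn2r ?nnegrE ?g0 ?cabs_ge0 ?(ltW e0) // => k.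
have p : 0 < r / 128 by rewrite divr_gt0.
by rewrite -(ler_pM2r p) !mulrA ltW.
Qed.

(* The difference quotients of the [s n] at [z] are uniformly Cauchy, hence their
   limit is a continuous difference quotient for [f]. *)
Lemma A2_limit_cdiff s f z : (forall n, A2 (s n)) -> energy_cauchy s ->
  (forall w, inD w -> ccvg (fun n => s n w) (f w)) -> inD z -> cdiff f z.
Proof.
move=> sA cs sf zD; have [r r0 sD] := room_in_disc zD.
have sD1 w : square z r w -> inD w by move=> ws; apply: sD; apply: square_le ws; lra.
have ds n w : square z r w -> cdiff (s n) w.
  by move=> /sD1; apply: holomorphic_cdiff; case: (sA n).
have zz : square z r z by apply/square_center/ltW.
have /choice[l Hl] (n : nat) : exists l, ccont (cquot (s n) z l) z.
  by apply: cdiff_cquot_ccont; exact: ds.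
pose q n := cquot (s n) z (l n).
(* A difference of quotients is the quotient of [s m - s n], so [cquot_le] makes it uniformly small
   as soon as [s m - s n] is, with no loss near [z]. *)
have qB m n w : q m w - q n w = cquot (fun w => s m w - s n w) z (l m - l n) w.
  by rewrite /q /cquot; case: eqVneq => // _; rewrite -mulrBl; congr (_ / _); ring.
have cqB m n : ccont (cquot (fun w => s m w - s n w) z (l m - l n)) z.
  apply: (@ccont_local _ _ (fun w => q m w + (-1) * q n w) _ 1) => // [w _|].
    by rewrite -qB mulN1r.
  by apply: ccontD; [exact: Hl|apply: ccontM; [exact: ccont_cst|exact: Hl]].
have uq e : 0 < e -> exists N, forall m n w, (N <= m)%N -> (N <= n)%N ->
    square z r w -> cabs (q m w - q n w) <= e.
  move=> e0; have er0 : 0 < e * r / 2 by rewrite divr_gt0 // mulr_gt0.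
  have [N HN] := A2_unif_cauchy sA cs r0 er0 sD.
  exists N => m n w Nm Nn ws; rewrite qB.
  have -> : e = 2 * (e * r / 2) / r by field; rewrite gt_eqF.
  apply: cquot_le => // v vs; last exact: HN.
  by apply: cdiffB; exact: ds.
have /choice[g Hg] w : exists gw, square z r w -> ccvg (fun n => q n w) gw.
  have [ws|nws] := pselect (square z r w); last by exists 0.
  have [|gw Hgw] := @complex_cauchy_cvg (fun n => q n w); last by exists gw.
  move=> e e0; have [|N HN] := uq (e / 2); first by rewrite divr_gt0.
  by exists N => m n Nm Nn; apply: le_lt_trans (HN m n w Nm Nn ws) _; lra.
have ug e : 0 < e -> exists n, forall w, square z r w -> cabs (q n w - g w) <= e.
  move=> /uq[N HN]; exists N => w ws.
  by apply: (ccvg_unif_le (Hg w ws) (N := N)) => // m n Nm Nn; exact: HN.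
exists g.
  move=> e e0; have [|n Hn] := ug (e / 4); first by rewrite divr_gt0.
  have [|d d0 Hd] := Hl n (e / 4); first by rewrite divr_gt0.
  exists (Num.min d r); first by rewrite lt_min d0.
  move=> w; rewrite lt_min => /andP[wd /ltW /cabs_le_square ws].
  have -> : g w - g z = (q n w - q n z) - (q n w - g w) + (q n z - g z) by ring.
  apply: (le_lt_trans (cabsD _ _)).
  have := cabsB (q n w - q n z) (q n w - g w).
  have := Hn w ws; have := Hn z zz; have := Hd w wd; rewrite -/(q n).
  lra.
exists r => // w /ltW /cabs_le_square ws.
apply/eqP; rewrite -subr_eq0; apply/eqP; apply: ccvg_dist_eq0 => e e0.
set D := cabs (w - z) + 1; have D1 : 1 <= D by rewrite lerDr cabs_ge0.
have D0 : 0 < D by lra.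
have e3 : 0 < e / 3 by rewrite divr_gt0.
have eD : 0 < e / 3 / D by rewrite divr_gt0.
have [N1 H1] := sf w (sD1 w ws) _ e3; have [N2 H2] := sf z zD _ e3.
have [N3 H3] := Hg w ws _ eD.
pose n := maxn N1 (maxn N2 N3).
have {}H1 := H1 n (leq_maxl _ _).
have {}H2 := H2 n (leq_trans (leq_maxl _ _) (leq_maxr _ _)).
have {}H3 := H3 n (leq_trans (leq_maxr _ _) (leq_maxr _ _)).
have sq : s n w = s n z + q n w * (w - z) by rewrite cquot_mul addrC subrK.
have -> : f w - (f z + g w * (w - z)) =
   (s n z - f z) - (s n w - f w) + (q n w - g w) * (w - z).
  by rewrite sq; ring.
apply: (le_trans (cabsD _ _)); rewrite cabsM.
have k1 := cabsB (s n z - f z) (s n w - f w).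
have k3 : cabs (q n w - g w) * cabs (w - z) <= e / 3.
  apply: (@le_trans _ _ (e / 3 / D * D)).
    by apply: ler_pM; rewrite ?cabs_ge0 // ?ltW // ltrDl.
  by rewrite divfK // gt_eqF.
lra.
Qed.

Lemma cabs_dist_le (x y : C) : `|cabs x - cabs y| <= cabs (x - y).
Proof.
have h1 : cabs x <= cabs y + cabs (x - y).
  have {1}-> : x = y + (x - y) by ring.
  exact: cabsD.
have h2 : cabs y <= cabs x + cabs (x - y).
  have {1}-> : y = x - (x - y) by ring.
  exact: cabsB.
by rewrite ler_norml; apply/andP; split; lra.
Qed.

(** Fatou's lemma. The conclusion is about the extended integral because it is also what proves that
    [f] is in [L2]. *)
Lemma L2_limit_energy_le s f h (e : R) : (forall n, L2 (s n)) -> L2 h ->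
  (forall w, inD w -> ccvg (fun n => s n w) (f w)) ->
  (forall n, energy (rlin h (-1) (s n)) <= e) ->
  (\int[@leb2 R]_(p in @disc R) (cabs (rlin h (-1) f (cplx p)) ^+ 2)%:E <= e%:E)%E.
Proof.
move=> sL hL sf se.
pose F n p := (cabs (rlin h (-1) (s n) (cplx p)) ^+ 2)%:E.
have L2s n : L2 (rlin h (-1) (s n)) by exact: L2_rlin.
have mF n : measurable_fun (@disc R : set (measurableTypeR R * measurableTypeR R)) (F n).
  by apply/measurable_EFinP; apply: measurable_normsq; case: (L2s n).
have F0 n p : @disc R p -> (0 <= F n p)%E by rewrite lee_fin sqr_ge0.
have := fatou (@leb2 R) (@measurable_disc R) mF F0 => fat.
apply: (@le_trans _ _ (\int[@leb2 R]_(p in @disc R) limn_einf (F^~ p))%E).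
  rewrite le_eqVlt; apply/orP; left; apply/eqP; apply: eq_integral => p.
  rewrite inE => pD; rewrite (cvg_limn_einf_sup (l := (cabs (rlin h (-1) f (cplx p)) ^+ 2)%:E)) //.
  apply: cvg_EFin; first exact: nearW.
  rewrite expr2.
  have c1 : (fun n => cabs (rlin h (-1) (s n) (cplx p))) @ \oo --> cabs (rlin h (-1) f (cplx p)).
    apply/cvgrPdist_lt => d d0; have [N HN] := sf (cplx p) pD d d0.
    exists N => // n /= Nn; apply: le_lt_trans (HN n Nn).
    apply: (le_trans (cabs_dist_le _ _)); rewrite !rlinN1.
    rewrite le_eqVlt; apply/orP; left; apply/eqP; congr (cabs _); ring.
  exact: (cvgM c1 c1).
apply: (le_trans fat); rewrite limn_einf_lim.
apply: lime_le; first exact: is_cvg_einfs.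
apply: nearW => n; apply: (@le_trans _ _ (energy (rlin h (-1) (s n)))%:E).
  rewrite -energyE //; apply: ereal_inf_lbound; exists n => //=.
by rewrite lee_fin.
Qed.

Lemma A2_complete_subspace : complete_subspace (@A2 R).
Proof.
split; [by exists (fun=> 0); exact: A2_0|by move=> f []|exact: A2_rlin|].
move=> s sA cs; have sL n : L2 (s n) by case: (sA n).
have /choice[f Hf] z : exists l, inD z -> ccvg (fun n => s n z) l.
  have [zD|nzD] := pselect (inD z); last by exists 0.
  have [|l Hl] := @complex_cauchy_cvg (fun n => s n z); last by exists l.
  move=> e e0; have [r r0 sD] := room_in_disc zD.
  have [|N HN] := A2_unif_cauchy sA cs r0 (_ : 0 < e / 2) sD.
    by rewrite divr_gt0.
  exists N => m n Nm Nn; have := HN m n z Nm Nn (square_center z (ltW r0)); lra.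
have hf : holomorphic_on_D f.
  by apply: cdiff_holomorphic => z; exact: A2_limit_cdiff.
have mf : cmeasurable f.
  split.
    apply: (measurable_fun_cvg (h := fun n p => complex.Re (s n (cplx p)))).
      by move=> n; case: (sL n) => -[].
    move=> p pD; apply/cvgrPdist_lt => e e0; have [N HN] := Hf _ pD e e0.
    exists N => // n /= Nn; apply: le_lt_trans (HN n Nn).
    by rewrite -ReB cabsBC; exact: normr_Re_le_cabs.
  apply: (measurable_fun_cvg (h := fun n p => complex.Im (s n (cplx p)))).
    by move=> n; case: (sL n) => -[].
  move=> p pD; apply/cvgrPdist_lt => e e0; have [N HN] := Hf _ pD e e0.
  exists N => // n /= Nn; apply: le_lt_trans (HN n Nn).
  by rewrite -ImB cabsBC; exact: normr_Im_le_cabs.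
(* The energy bound holds only from index [N] on, so Fatou's lemma is applied to the shifted
   sequence. *)
have tail N w : inD w -> ccvg (fun n => s (N + n)%N w) (f w).
  move=> wD e e0; have [N' HN'] := Hf _ wD e e0; exists N' => n Nn; apply: HN'.
  by rewrite (leq_trans Nn) // leq_addl.
have bound e : 0 < e -> exists N, forall n, (N <= n)%N ->
  (\int[@leb2 R]_(p in @disc R) (cabs (rlin (s n) (-1) f (cplx p)) ^+ 2)%:E <= e%:E)%E.
  move=> /cs[N HN]; exists N => n Nn.
  apply: (@L2_limit_energy_le (fun m => s (N + m)%N)) => //; first exact: tail.
  by move=> m; apply/ltW/HN => //; exact: leq_addr.
have fL : L2 f.
  have [N HN] := bound _ (@ltr01 R).
  have dL : L2 (rlin (s N) (-1) f).
    split; last by apply: le_lt_trans (HN N (leqnn N)) _; rewrite ltry.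
    case: (sL N) mf => -[m1 m2] _ [m3 m4]; split.
      apply: (eq_measurable_fun (fun p => complex.Re (s N (cplx p)) + -1 * complex.Re (f (cplx p)))).
        by move=> p _; rewrite Re_rlin.
      by apply: measurable_funD => //; exact: measurable_funM.
    apply: (eq_measurable_fun (fun p => complex.Im (s N (cplx p)) + -1 * complex.Im (f (cplx p)))).
      by move=> p _; rewrite Im_rlin.
    by apply: measurable_funD => //; exact: measurable_funM.
  (* Fatou's lemma puts the difference [s N - f] in [L2], and [f] is recovered as
     [s N - (s N - f)]. *)
  have -> : f = rlin (s N) (-1) (rlin (s N) (-1) f).
    by apply/funext => z; rewrite !rlinN1; ring.
  exact: L2_rlin.
exists f => // e e0; have [|N HN] := bound (e / 2); first by rewrite divr_gt0.
exists N => n Nn; have := HN n Nn; rewrite energyE; last exact: L2_rlin.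
by rewrite lee_fin; lra.
Qed.

End BergmanComplete.

(** * Toeplitz operators: coercivity implies invertibility *)

Section ToeplitzOperators.
Variable R : realType.
Local Notation C := R[i].
Implicit Types (phi u v f g h : C -> C) (z w : C).

(** The imaginary part of [u conj(v)] is the real part of [u conj(i v)]. *)
Lemma inner_bform u v : inner u v =
  (pi^-1 * bform u v +i* (pi^-1 * bform u (fun z => 'i%C * v z)))%C.
Proof.
rewrite /inner /cintD /intD /bform; congr (_ * _ +i* (_ * _))%C;
  apply: eq_Rintegral => p _ /=; rewrite !(ReM, ImM) /=.
  by case: (v (cplx p)) => x y /=; ring.
by case: (v (cplx p)) => x y /=; ring.
Qed.

(** Testing against both [h] and [i h], which lies in [A2] as well, recovers the complex identity
    from the real one. *)
Lemma toeplitz_bform phi f g : toeplitz phi f g <->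
  A2 g /\ forall h, A2 h -> bform (fun z => phi z * f z) h = bform g h.
Proof.
have pi0 : (pi^-1 : R) != 0 by rewrite invr_eq0 gt_eqF // pi_gt0.
split=> [[gA H]|[gA H]]; split=> // h hA.
  have := H h hA; rewrite !inner_bform => -[/(mulfI pi0)] //.
by rewrite !inner_bform !H //; exact: A2_muli.
Qed.

Lemma Linf_bounded phi : Linf phi -> exists2 M : R, 0 <= M &
  {ae (@leb2 R), forall p, disc p -> cabs (phi (cplx p)) <= M}.
Proof.
move=> [_ phiL].
have [M HM] := ess_supr_bounded phiL.
exists (Num.max M 0); first by rewrite le_max lexx orbT.
apply: filterS HM => p /= + pD; rewrite asboolT // => h.
by rewrite le_max h.
Qed.

Lemma L2_mul_Linf phi : Linf phi -> exists M : R, forall f, L2 f ->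
  L2 (fun z => phi z * f z) /\ energy (fun z => phi z * f z) <= M * energy f.
Proof.
move=> phiL; have [M M0 HM] := Linf_bounded phiL.
exists (M ^+ 2) => f fL; have md := @measurable_disc R.
have mc : cmeasurable (fun z => phi z * f z).
  case: phiL fL => -[m1 m2] _ [[m3 m4] _]; split.
    apply: (eq_measurable_fun (fun p =>
      complex.Re (phi (cplx p)) * complex.Re (f (cplx p)) -
      complex.Im (phi (cplx p)) * complex.Im (f (cplx p)))).
      by move=> p _; rewrite ReM.
    by apply: measurable_funB; exact: measurable_funM.
  apply: (eq_measurable_fun (fun p =>
    complex.Re (phi (cplx p)) * complex.Im (f (cplx p)) +
    complex.Im (phi (cplx p)) * complex.Re (f (cplx p)))).
    by move=> p _; rewrite ImM.
  by apply: measurable_funD; exact: measurable_funM.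
have ifL := L2_integrable_normsq fL.
have le : (\int[@leb2 R]_(p in @disc R) (cabs (phi (cplx p) * f (cplx p)) ^+ 2)%:E <=
    (M ^+ 2 * energy f)%:E)%E.
  rewrite EFinM -energyE // -(integralZl md ifL).
  apply: (ae_ge0_le_integral md).
  - by move=> p _; rewrite lee_fin sqr_ge0.
  - by apply/measurable_EFinP; exact: measurable_normsq mc.
  - by move=> p _; rewrite -EFinM lee_fin mulr_ge0 ?sqr_ge0.
  - by case/integrableP: (integrableZl md (M ^+ 2) ifL).
  - have aeF : Filter (almost_everywhere (@leb2 R)) by exact: ae_filter_ringOfSetsType.
    apply: filterS HM => p h pD; rewrite -EFinM lee_fin cabsM exprMn.
    by rewrite ler_wpM2r ?sqr_ge0 // ler_pXn2r ?nnegrE ?cabs_ge0 // h.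
have pL : L2 (fun z => phi z * f z).
  by split=> //; apply: le_lt_trans le _; rewrite ltry.
by split=> //; rewrite -lee_fin -energyE.
Qed.

(** Point evaluations turn zero energy into vanishing at every point of the disc, as injectivity in
    [toeplitz_invertible] demands. *)
Lemma A2_energy_eq0 f z : A2 f -> energy f <= 0 -> inD z -> f z = 0.
Proof.
move=> [hf fL] f0 zD; have [r r0 sD] := room_in_disc zD.
have sD1 w : square z r w -> inD w by move=> ws; apply: sD; apply: square_le ws; lra.
have h := le_trans (point_evaluation_le hf fL r0 sD1) f0.
apply/eqP; rewrite -cabs_eq0.
have : (cabs (f z) * r / 128) ^+ 2 == 0 by rewrite eq_le h sqr_ge0.
by rewrite sqrf_eq0 !mulf_eq0 invr_eq0 (gt_eqF r0) orbF pnatr_eq0 orbF.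
Qed.

Lemma mul_rlin phi f (r : R) g :
  (fun z => phi z * rlin f r g z) =
  rlin (fun z => phi z * f z) r (fun z => phi z * g z).
Proof. by apply/funext => z; rewrite /rlin; ring. Qed.

Section Coercive.
Variables (phi : C -> C) (c : R).
Hypotheses (phiL : Linf phi) (c0 : 0 < c).
Hypothesis coercive : forall f, A2 f ->
  c * energy f <= bform (fun z => phi z * f z) f.

Let mul_L2 f : A2 f -> L2 (fun z => phi z * f z).
Proof. by move=> [_ fL]; have [M H] := L2_mul_Linf phiL; case: (H f fL). Qed.

Lemma toeplitz_exists f : A2 f -> exists g, toeplitz phi f g.
Proof.
move=> fA; have [g gA Hg] := orthogonal_projection (@A2_complete_subspace R) (mul_L2 fA).
by exists g; apply/toeplitz_bform.
Qed.

Lemma toeplitz_rlin f1 g1 (r : R) f2 g2 : A2 f1 -> A2 f2 ->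
  toeplitz phi f1 g1 -> toeplitz phi f2 g2 ->
  toeplitz phi (rlin f1 r f2) (rlin g1 r g2).
Proof.
move=> f1A f2A /toeplitz_bform[g1A H1] /toeplitz_bform[g2A H2].
apply/toeplitz_bform; split; first exact: A2_rlin.
move=> h hA; have [[[_ g1L] [_ g2L]] [_ hL]] := (g1A, g2A, hA).
by rewrite mul_rlin !bform_rlinl ?H1 ?H2 //; exact: mul_L2.
Qed.

(** Expand [energy (g - c f) >= 0] and use that [bform g f], being [bform (phi f) f], is at least
    [c * energy f]. *)
Lemma toeplitz_energy_ge f g : A2 f -> toeplitz phi f g ->
  c ^+ 2 * energy f <= energy g.
Proof.
move=> fA /toeplitz_bform[gA H]; have [[_ fL] [_ gL]] := (fA, gA).
have := coercive fA; rewrite H // => h.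
have := energy_ge0 (rlin g (- c) f); rewrite energy_rlin //.
have : c * (c * energy f) <= c * bform g f by rewrite ler_pM2l.
by rewrite sqrrN expr2; lra.
Qed.

(** By orthogonality the energy of [phi f - g] is the difference of the two energies. *)
Lemma toeplitz_energy_le f g : A2 f -> toeplitz phi f g ->
  energy g <= energy (fun z => phi z * f z).
Proof.
move=> fA /toeplitz_bform[gA H]; have [_ gL] := gA; have pL := mul_L2 fA.
have := energy_ge0 (rlin (fun z => phi z * f z) (-1) g).
by rewrite energy_rlin // H // bform_energy; lra.
Qed.

Let range g := exists2 f, A2 f & toeplitz phi f g.

Lemma toeplitz_range_complete : complete_subspace range.
Proof.
(* The lower bound makes preimages of a Cauchy sequence Cauchy; they converge in [A2], and
   boundedness of the operator sends their limit to a limit of the given sequence. *)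
split.
- by have [g] := toeplitz_exists (@A2_0 R); exists g, (fun=> 0) => //; exact: A2_0.
- by move=> g [f _ /toeplitz_bform[[]]].
- move=> g1 r g2 [f1 f1A t1] [f2 f2A t2]; exists (rlin f1 r f2).
    exact: A2_rlin.
  exact: toeplitz_rlin.
move=> s sR cs.
have /choice[F HF] (n : nat) : exists f, A2 f /\ toeplitz phi f (s n).
  by have [f fA t] := sR n; exists f.
have FA n : A2 (F n) by case: (HF n).
have Ft n : toeplitz phi (F n) (s n) by case: (HF n).
have cF : energy_cauchy F.
  move=> e e0; have [|N HN] := cs (c ^+ 2 * e); first by rewrite mulr_gt0 ?exprn_gt0.
  exists N => m n Nm Nn; rewrite -(ltr_pM2l (exprn_gt0 2 c0)).
  apply: le_lt_trans (HN m n Nm Nn); apply: toeplitz_energy_ge.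
    exact: A2_rlin.
  exact: toeplitz_rlin.
have [_ _ _ comp] := @A2_complete_subspace R.
have [f fA Ff] := comp F FA cF; have [g t] := toeplitz_exists fA.
exists g; first by exists f.
have [M HM] := L2_mul_Linf phiL.
move=> e e0; have d0 : 0 < e / (`|M| + 1) by rewrite divr_gt0 // ltr_wpDl.
have [N HN] := Ff _ d0; exists N => n Nn.
have dA : A2 (rlin (F n) (-1) f) by exact: A2_rlin.
have [_ dL] := dA; have [_ h] := HM _ dL.
have td := toeplitz_rlin (-1) (FA n) fA (Ft n) t.
apply: (le_lt_trans (toeplitz_energy_le dA td)); apply: (le_lt_trans h).
have := HN n Nn; rewrite ltr_pdivlMr ?ltr_wpDl // => k.
have E0 := energy_ge0 (rlin (F n) (-1) f); apply: le_lt_trans k.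
rewrite mulrC ler_wpM2l //; have := ler_norm M; lra.
Qed.

(** For surjectivity, let [r] be [g] minus its projection [g'] onto the range. Then [r] is
    orthogonal to its own image, so [c * energy r <= bform (phi r) r = 0]. Injectivity and the bound
    [c^-1] on the inverse come from [toeplitz_energy_ge]. *)
Lemma coercive_toeplitz_invertible : toeplitz_invertible phi.
Proof.
split=> [g gA|].
  have [_ gL] := gA.
  have [g' [f fA t] Hg'] := orthogonal_projection toeplitz_range_complete gL.
  have /toeplitz_bform[g'A Ht] := t.
  have rA : A2 (rlin g (-1) g') by exact: A2_rlin.
  have [k tk] := toeplitz_exists rA.
  have kR : range k by exists (rlin g (-1) g').
  have /toeplitz_bform[[_ kL] Hk] := tk.
  have [_ g'L] := g'A; have [_ rL] := rA.
  have r0 : energy (rlin g (-1) g') <= 0.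
    have := coercive rA; rewrite Hk // bformC bform_rlinl // Hg' //.
    by rewrite mulN1r subrr pmulr_rle0.
  (* [f] is a preimage of [g']; since [g - g'] has zero energy, Cauchy-Schwarz shows that [g] and
     [g'] pair equally with every [h]. *)
  exists f; split=> //; apply/toeplitz_bform; split=> // h hA.
  have [_ hL] := hA.
  have : bform (rlin g (-1) g') h ^+ 2 <= 0.
    apply: (le_trans (bform_cauchy_schwarz rL hL)).
    by rewrite mulr_le0_ge0 ?energy_ge0.
  rewrite Ht // bform_rlinl // => q.
  have : (bform g h + -1 * bform g' h) ^+ 2 == 0 by rewrite eq_le q sqr_ge0.
  by rewrite sqrf_eq0 mulN1r subr_eq0 => /eqP.
split=> [f1 f2 g f1A f2A t1 t2 z zD|].
  have dA : A2 (rlin f1 (-1) f2) by exact: A2_rlin.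
  have td := toeplitz_rlin (-1) f1A f2A t1 t2.
  have /toeplitz_bform[[_ gL] _] := t1.
  have := toeplitz_energy_ge dA td; rewrite (energy_rlin (-1) gL gL) bform_energy.
  have -> : energy g + 2 * -1 * energy g + (-1) ^+ 2 * energy g = 0 by ring.
  rewrite pmulr_rle0 ?exprn_gt0 // => d0.
  have := A2_energy_eq0 dA d0 zD; rewrite rlinN1 => /eqP.
  by rewrite subr_eq0 => /eqP.
exists c^-1; first by rewrite invr_gt0.
move=> f g fA t; rewrite -(ler_pM2l c0) mulrA divff ?gt_eqF // mul1r.
rewrite /L2norm /intD -{1}(gtr0_norm c0) -sqrtr_sqr -sqrtrM ?sqr_ge0 //.
apply: ler_wsqrtr; rewrite mulrCA ler_wpM2l ?invr_ge0 ?pi_ge0 //.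
exact: toeplitz_energy_ge.
Qed.

End Coercive.

End ToeplitzOperators.

(** * The coercivity estimate *)

Section CoercivityEstimate.
Variable R : realType.
Local Notation C := R[i].

(** If [x < rho^2 / 2], then [x <= 1], so [x^2 + y^2 <= 2 x < rho^2]. *)
Lemma Re_ge_of_parabola (x y rho : R) : 0 < rho < 1 ->
  rho ^+ 2 <= x ^+ 2 + y ^+ 2 -> y ^+ 2 <= x -> rho ^+ 2 / 2 <= x.
Proof.
move=> /andP[r0 r1] h1 h2; rewrite leNgt; apply/negP => xl.
have x0 : 0 <= x by exact: le_trans (sqr_ge0 y) h2.
have r2 : rho ^+ 2 <= 1 by rewrite expr_le1 // ltW.
have : x ^+ 2 <= x by rewrite expr2 ler_piMr //; lra.
lra.
Qed.

(** The left side is the loss caused by [Lambda], as a coefficient of the energy; the right side is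
    half of the gain [rho^2 / 2]. *)
Lemma small_disc_bound (rho m : R) : 0 < rho -> 32 * rho < 1 -> m <= 4 * rho ^+ 6 ->
  2 * rho * 512 ^+ 2 * m <= rho ^+ 2 / 4.
Proof.
move=> r0 r1 hm.
apply: (@le_trans _ _ (2 * rho * 512 ^+ 2 * (4 * rho ^+ 6))).
  apply: ler_wpM2l hm; apply: mulr_ge0; last exact: sqr_ge0.
  by rewrite mulr_ge0 // ltW.
(* For [rho < 1/32] the factors multiplying [rho^2] are at most [16^2], [1/4] and [1/32^2], with
   product [1/16]. *)
have -> : 2 * rho * 512 ^+ 2 * (4 * rho ^+ 6) =
  rho ^+ 2 * ((512 * rho) ^+ 2 * ((8 * rho) * rho ^+ 2)) by ring.
rewrite ler_pM2l ?exprn_gt0 //.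
have s1 : (512 * rho) ^+ 2 <= 16 ^+ 2.
  by rewrite (ler_pXn2r (isT : (0 < 2)%N)) ?nnegrE; lra.
have s2 : rho ^+ 2 <= 32^-1 ^+ 2 by rewrite ler_pXn2r ?nnegrE //; lra.
have s3 : 8 * rho * rho ^+ 2 <= 4^-1 * 32^-1 ^+ 2.
  by apply: ler_pM => //; rewrite ?sqr_ge0 //; lra.
have r3 : 0 <= 8 * rho * rho ^+ 2 by rewrite mulr_ge0 ?sqr_ge0 //; lra.
apply: (@le_trans _ _ (16 ^+ 2 * (4^-1 * 32^-1 ^+ 2))).
  by apply: ler_pM; [exact: sqr_ge0|exact: r3|exact: s1|exact: s3].
lra.
Qed.

(** A square of half-side [1/4] around [z] stays in the disc, since [2/4 + 1/32 < 1]; then 512 is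
    [4 * 128]. *)
Lemma point_evaluation_center (f : C -> C) z : A2 f -> cabs z < 32^-1 ->
  cabs (f z) ^+ 2 <= 512 ^+ 2 * energy f.
Proof.
move=> [hf fL] z1; have q0 : 0 < 4^-1 :> R by rewrite invr_gt0.
have sD w : square z 4^-1 w -> inD w.
  move=> /square_cabs_le wz; apply: (@inD_cabs _ z); lra.
have -> : cabs (f z) ^+ 2 = 512 ^+ 2 * (cabs (f z) * 4^-1 / 128) ^+ 2 by field.
rewrite ler_pM2l; first exact: point_evaluation_le.
by rewrite exprn_gt0 ?ltr0n.
Qed.

Lemma bform_mul (phi f : C -> C) p :
  complex.Re (phi (cplx p) * f (cplx p)) * complex.Re (f (cplx p)) +
  complex.Im (phi (cplx p) * f (cplx p)) * complex.Im (f (cplx p)) =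
  complex.Re (phi (cplx p)) * cabs (f (cplx p)) ^+ 2.
Proof. by rewrite ReM ImM sqr_cabs; ring. Qed.

Lemma toeplitz_coercive (phi : C -> C) (rho : R) : Linf phi ->
  0 < rho -> 32 * rho < 1 ->
  (forall z, inD z -> rho <= cabs (phi z) ->
     `|complex.Im (phi z)| ^+ 2 <= complex.Re (phi z)) ->
  (forall z, inD z -> rho <= cabs z -> rho < cabs (phi z)) ->
  (area [set p | disc p /\ (cabs (phi (cplx p)) <= rho)%R] <= (rho ^+ 6)%:E)%E ->
  forall f, A2 f -> rho ^+ 2 / 4 * energy f <= bform (fun z => phi z * f z) f.
Proof.
move=> phiL r0 r1 Hre Hloc Harea f fA; have [_ fL] := fA.
have md := @measurable_disc R.
set L : set (measurableTypeR R * measurableTypeR R) := [set p | _ /\ _] in Harea *.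
have mL : measurable L.
  have -> : L = @disc R `&` (fun p => cabs (phi (cplx p)) ^+ 2) @^-1` `]-oo, rho ^+ 2]%classic.
    apply/seteqP; split => p /= [pD h]; split => //.
      by rewrite in_itv /= ler_pXn2r ?nnegrE ?cabs_ge0 ?(ltW r0) // ?ltW.
    by move: h; rewrite in_itv /= ler_pXn2r ?nnegrE ?cabs_ge0 ?(ltW r0) // ?ltW.
  case: phiL => mphi _; exact: (measurable_normsq mphi).
(* Lebesgue measure is pi times [area], and pi is less than 4. *)
have muL : (@leb2 R L <= (4 * rho ^+ 6)%:E)%E.
  move: Harea; rewrite /area lee_pdivrMl ?pi_gt0 // => /le_trans; apply.
  rewrite -EFinM lee_fin ler_pM2r ?exprn_gt0 //.
  by have := pihalf_lt2 R; lra.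
have LD : L `&` @disc R = L by apply/setIidPl => p [].
have intL : (\int[@leb2 R]_(p in @disc R) (\1_L p)%:E = @leb2 R L)%E.
  by apply: (etrans (integral_indic _ md mL)); rewrite LD.
have finL : @leb2 R L \is a fin_num.
  by rewrite ge0_fin_numE //; apply: le_lt_trans muL _; rewrite ltry.
have iL : (@leb2 R).-integrable (@disc R) (EFin \o \1_L).
  apply/integrableP; split.
    by apply/measurable_EFinP; exact: measurable_indic.
  apply: (@le_lt_trans _ _ (@leb2 R L)); last by rewrite -ge0_fin_numE.
  rewrite -intL le_eqVlt; apply/orP; left; apply/eqP.
  by apply: eq_integral => p _ /=; rewrite ger0_norm // indicE ler0n.
have L1 : Rintegral (@leb2 R) (@disc R) \1_L = fine (@leb2 R L).
  by rewrite /Rintegral intL.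
set m := fine (@leb2 R L) in L1.
have m4 : m <= 4 * rho ^+ 6 by rewrite -lee_fin fineK.
(* On [L], passing from the lower bound [- rho |f|^2] to [rho^2 / 2 |f|^2] costs at most
   [2 rho |f|^2], which point evaluation bounds by the constant [B]. *)
pose B := 2 * rho * (512 ^+ 2 * energy f).
have inf := L2_integrable_normsq fL.
have pL : L2 (fun z => phi z * f z).
  by have [M H] := L2_mul_Linf phiL; case: (H f fL).
have low : Rintegral (@leb2 R) (@disc R)
    (fun p => rho ^+ 2 / 2 * cabs (f (cplx p)) ^+ 2 - B * \1_L p) <=
    bform (fun z => phi z * f z) f.
  apply: le_Rintegral => //.
  - exact: (integrableB md (integrableZl md (rho ^+ 2 / 2) inf) (integrableZl md B iL)).
  - exact: (L2_integrable_bform pL fL).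
  move=> p pD; rewrite bform_mul indicE.
  set n := cabs (f (cplx p)) ^+ 2; have n0 : 0 <= n by rewrite sqr_ge0.
  have [pL'|npL] := boolP (p \in L).
    rewrite inE in pL'; case: pL' => _ pr.
    (* By localization, a point where [|phi| <= rho] has modulus less than [rho]. *)
    have zr : cabs (cplx p) < 32^-1.
      have : cabs (cplx p) < rho.
        by rewrite ltNge; apply/negP => /(Hloc _ pD); rewrite ltNge pr.
      lra.
    have nE : n <= 512 ^+ 2 * energy f by exact: point_evaluation_center.
    have x1 : - rho <= complex.Re (phi (cplx p)).
      by have := le_trans (normr_Re_le_cabs _) pr; rewrite ler_norml => /andP[].
    have x2 : - rho * n <= complex.Re (phi (cplx p)) * n by rewrite ler_wpM2r.
    have x3 : 2 * rho * n <= B by rewrite /B ler_pM2l // mulr_gt0.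
    have x4 : rho ^+ 2 / 2 * n <= rho * n.
      rewrite ler_wpM2r // expr2 -mulrA ler_piMr //; lra.
    by rewrite mulr1; lra.
  rewrite mulr0 subr0 ler_wpM2r //.
  have pr : rho < cabs (phi (cplx p)).
    by rewrite ltNge; apply/negP => h; move/negP: npL; apply; rewrite inE; split.
  apply: (Re_ge_of_parabola (y := complex.Im (phi (cplx p)))).
  - by rewrite r0 /=; lra.
  - by rewrite -sqr_cabs ler_pXn2r ?nnegrE ?cabs_ge0 ?(ltW r0) // ?ltW.
  - by rewrite -(real_normK (num_real _)); apply: Hre => //; exact: ltW.
apply: le_trans low; rewrite RintegralB //; first last.
- exact: (integrableZl md B iL).
- exact: (integrableZl md (rho ^+ 2 / 2) inf).
rewrite (RintegralZl _ md inf) (RintegralZl _ md iL) -/(energy f) L1.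
have E0 := energy_ge0 f.
have := ler_wpM2r E0 (small_disc_bound r0 r1 m4).
by rewrite /B; lra.
Qed.

End CoercivityEstimate.

(* rho in (0, rho0), rho0 = (1/32) min(1, ||phi||_oo^{-1}), is written out as
   0 < rho, 32 rho < 1 and 32 rho ||phi||_oo < 1. *)
Theorem theorem4p1 (R : realType) (phi : R[i] -> R[i]) (rho : R) :
  Linf phi ->
  0 < rho -> 32 * rho < 1 -> ((32 * rho)%:E * Linfnorm phi < 1%:E)%E ->
  (forall z, inD z -> rho <= cabs (phi z) ->
     `|complex.Im (phi z)| ^+ 2 <= complex.Re (phi z)) ->
  (forall z, inD z -> rho <= cabs z -> rho < cabs (phi z)) ->
  (area [set p | disc p /\ (cabs (phi (cplx p)) <= rho)%R] <= (rho ^+ 6)%:E)%E ->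
  toeplitz_invertible phi.
Proof.
move=> phiL r0 r1 _ Hre Hloc Harea.
have c0 : 0 < rho ^+ 2 / 4 by rewrite divr_gt0 // exprn_gt0.
exact: (coercive_toeplitz_invertible phiL c0 (toeplitz_coercive phiL r0 r1 Hre Hloc Harea)).
Qed.
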